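(* Let $\mathcal{X}$ be a nuclear Fréchet space with the properties $\underline{DN}$ and $\Omega$. Assume also that the associated exponent sequence $\mathcal{E}=(\mathcal{E}_n)_n$ of $\mathcal{X}$ is a nuclear exponent sequence of finite type (i.e. $\Lambda_1(\mathcal{E})$ is nuclear). Then the following assertions are equivalent: (1) $\delta(\mathcal{X})=\delta(\Lambda_1(\mathcal{E}))$; (2) $\displaystyle\inf_{1\le p<\infty}\ \sup_{q>p}\ \limsup_{n}\frac{\mathcal{E}_n(p,q)}{\mathcal{E}_n}=0$; (3) there exists an $r$-local imbedding from $\Lambda_1(\mathcal{E})$ into $\mathcal{X}$ for every $0<r<1$.
   Context: Properties $\underline{DN}$ and $\Omega$: a nuclear Fréchet space $\mathcal{X}$ has $\underline{DN}$ and $\Omega$ if there is an increasing fundamental system of Hilbertian norms $\{\|\cdot\|_k\}_{k=0,1,2,\dots}$ generating its topology, with closed unit balls $U_k$, such that ($\underline{DN}$) for every $k$ there are $0<\lambda<1$ and $C>0$ with $\|x\|_{k+1}\le C\|x\|_k^{\lambda}\|x\|_{k+2}^{1-\lambda}$ for all $x\in\mathcal{X}$; ($\Omega$) for all $k$ and $p$ there are $C>0$ and $j\in\mathbb{N}$ with $U_{k+1}\subset C r^j U_p+\frac1r U_k$ for all $r>0$. Such a grading is fixed. Kolmogorov diameters: $d_n(V,U)=\inf_{L}\inf\{\lambda>0: V\subseteq\lambda U+L\}$, where $L$ runs over linear subspaces of dimension at most $n$. For $p<q$, $\mathcal{E}_n(p,q)=-\ln d_n(U_q,U_p)$. Associated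 exponent sequence: $\mathcal{E}_n=\mathcal{E}_n(0,1)$, $n=0,1,2,\dots$ (up to equivalence of sequences it does not depend on the choices). Power series space of finite type: $\Lambda_1(\mathcal{E})=\{(\xi_n)_{n\ge0}: |(\xi_n)|_r=(\sum_n|\xi_n|^2e^{2r\mathcal{E}_n})^{1/2}<\infty\ \ \forall\, -\infty<r<1\}$ with the Fréchet topology given by the norms $|\cdot|_r$, $r<1$; it is nuclear iff $\lim_n\ln(n)/\mathcal{E}_n=0$. Approximate diametral dimension: for a Fréchet space $Y$, $\delta(Y)=\{(t_n)_n:$ there exist a neighborhood of zero $U$ and a bounded set $B$ of $Y$ with $\lim_n t_n/d_n(B,U)=0\}$ (in particular $d_n(B,U)>0$ for all $n$). Local imbedding: an $r$-local imbedding from $\Lambda_1(\mathcal{E})$ into $\mathcal{X}$ is a continuous linear operator $T:\Lambda_1(\mathcal{E})\to\mathcal{X}$ for which there exist a continuous semi-norm $\|\cdot\|$ on $\mathcal{X}$ and $C>0$ with $\|T(x)\|\ge C|x|_r$ for all $x\in\Lambda_1(\mathcal{E})$. *)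

(* Defs.v *)
From HB Require Import structures.
From mathcomp Require Import all_boot all_order all_algebra.
From mathcomp Require Import complex.
From mathcomp Require Import ring.
From mathcomp Require Import all_classical all_reals all_analysis.

Set Implicit Arguments.
Unset Strict Implicit.
Unset Printing Implicit Defensive.

Import Order.TTheory GRing.Theory Num.Theory.
Import numFieldNormedType.Exports.

Local Open Scope classical_set_scope.
Local Open Scope ring_scope.

(* Everything below is over the real or the complex field. *)
Variant scalars := RealScalars | ComplexScalars.

Definition scalar_field (R : realType) (s : scalars) : numFieldType :=
  match s with
  | RealScalars => R
  | ComplexScalars => R[i]
  end.

Definition of_real (R : realType) (s : scalars) :
    {rmorphism R -> scalar_field R s} :=
  match s with
  | RealScalars => idfun
  | ComplexScalars => real_complex R
  end.

(* [`|z|] lives in the scalar field itself; [modulus z] is the same number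
   read in [R], see [normr_modulus]. *)
Definition modulus (R : realType) (s : scalars) : scalar_field R s -> R :=
  match s with
  | RealScalars => fun z : R => `|z|
  | ComplexScalars => fun z : R[i] => complex.Re `|z|
  end.

Definition conjugate (R : realType) (s : scalars) :
    scalar_field R s -> scalar_field R s :=
  match s with
  | RealScalars => fun z : R => z
  | ComplexScalars => fun z : R[i] => conjc z
  end.

Arguments of_real {R s}.
Arguments modulus {R s}.
Arguments conjugate {R s}.

Section Scalars.
Context {R : realType} {s : scalars}.
Local Notation K := (scalar_field R s).
Implicit Types (z w : K) (x y : R).

Lemma normr_modulus z : `|z| = of_real (modulus z).
Proof. by case: s z => //= z; rewrite normc_def. Qed.

Lemma ler_of_real x y : (of_real x <= of_real y :> K) = (x <= y).
Proof. by case: s => //=; rewrite lecR. Qed.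

Lemma ltr_of_real x y : (of_real x < of_real y :> K) = (x < y).
Proof. by case: s => //=; rewrite ltcR. Qed.

Lemma of_real_inj : injective (of_real : R -> K).
Proof. exact: fmorph_inj. Qed.

Lemma modulus_ge0 z : 0 <= modulus z.
Proof. by rewrite -ler_of_real -normr_modulus rmorph0. Qed.

Lemma modulusM z w : modulus (z * w) = modulus z * modulus w.
Proof. by apply: of_real_inj; rewrite rmorphM/= -!normr_modulus normrM. Qed.

Lemma modulusD z w : modulus (z + w) <= modulus z + modulus w.
Proof. by rewrite -ler_of_real rmorphD/= -!normr_modulus ler_normD. Qed.

Lemma modulus0 : modulus (0 : K) = 0.
Proof. by apply: of_real_inj; rewrite -normr_modulus normr0 rmorph0. Qed.

Lemma modulus_of_real x : modulus (of_real x : K) = `|x|.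
Proof.
apply: of_real_inj; rewrite -normr_modulus; case: s => //=.
by rewrite normc_def /= expr0n /= addr0 sqrtr_sqr.
Qed.

Lemma modulusN z : modulus (- z) = modulus z.
Proof. by apply: of_real_inj; rewrite -!normr_modulus normrN. Qed.

End Scalars.

Section Seminorms.
Context {R : realType} {s : scalars}.
Local Notation K := (scalar_field R s).

Record seminorm (V : lmodType K) (p : V -> R) : Prop := {
  seminorm_ge0 : forall x, 0 <= p x ;
  seminormD : forall x y, p (x + y) <= p x + p y ;
  seminormZ : forall a x, p (a *: x) = modulus a * p x
}.

Definition hilbertian_norm (V : lmodType K) (p : V -> R) :=
  [/\ seminorm p,
      forall x, p x = 0 -> x = 0 &
      exists h : V -> V -> K,
        [/\ forall a x y z, h (a *: x + y) z = a * h x z + h y z,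
            forall x y, h y x = conjugate (h x y) &
            forall x, h x x = of_real (p x ^+ 2)]].

Lemma seminorm0 (V : lmodType K) (p : V -> R) : seminorm p -> p 0 = 0.
Proof. by move=> hp; rewrite -(scale0r 0) (seminormZ hp) modulus0 mul0r. Qed.

Lemma seminormN (V : lmodType K) (p : V -> R) x :
  seminorm p -> p (- x) = p x.
Proof.
move=> hp; rewrite -scaleN1r (seminormZ hp) modulusN.
by rewrite -[1](rmorph1 (of_real : {rmorphism R -> K})) modulus_of_real normr1 mul1r.
Qed.

Lemma seminormB (V : lmodType K) (p : V -> R) x y :
  seminorm p -> p (x - y) <= p x + p y.
Proof.
by move=> hp; rewrite -(seminormN y hp); exact: (seminormD hp).
Qed.

Section SeminormNbhs.
Context {I : eqType} {V : lmodType K} (P : I -> V -> R).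

(* Neighbourhoods of the coarsest vector space topology for which every [P i]
   is continuous. *)
Definition seminorm_nbhs (x : V) : set_system V :=
  [set A | exists (l : seq I) (e : R),
     0 < e /\ forall y, (forall i, i \in l -> P i (y - x) < e) -> A y].

Hypothesis hP : forall i, seminorm (P i).

Lemma seminorm_nbhs_filter x : ProperFilter (seminorm_nbhs x).
Proof.
split.
  move=> [l [e [e0 H]]]; apply: (H x) => i _.
  by rewrite subrr (seminorm0 (hP i)).
split.
- by exists [::], 1; split.
- move=> A B [l [e [e0 H]]] [k [d [d0 G]]]; exists (l ++ k), (Num.min e d).
  split; first by rewrite lt_min e0.
  move=> y Hy; split.
    by apply: H => i il; have := Hy i; rewrite mem_cat il lt_min => /(_ isT)/andP[].
  by apply: G => i il; have := Hy i; rewrite mem_cat il orbT lt_min => /(_ isT)/andP[].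
- by move=> A B AB [l [e [e0 H]]]; exists l, e; split => // y /H/AB.
Qed.

Lemma seminorm_nbhs_singleton x A : seminorm_nbhs x A -> A x.
Proof.
by move=> [l [e [e0 H]]]; apply: H => i _; rewrite subrr (seminorm0 (hP i)).
Qed.

Lemma seminorm_nbhs_ball (l : seq I) (e : R) x y :
    (forall i, i \in l -> P i (y - x) < e) ->
  0 < e -> seminorm_nbhs y [set z | forall i, i \in l -> P i (z - x) < e].
Proof.
move=> Hy e0.
have [d d0 Hd] : exists2 d, 0 < d & forall i, i \in l -> P i (y - x) + d <= e.
  elim: l Hy => [|i l IH] Hy; first by exists 1.
  have [|d d0 Hd] := IH; first by move=> j jl; apply: Hy; rewrite inE jl orbT.
  exists (Num.min d (e - P i (y - x))).
    by rewrite lt_min d0 subr_gt0 Hy// mem_head.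
  move=> j; rewrite inE => /predU1P[->|jl].
    by rewrite -lerBrDl ge_min lexx orbT.
  by apply: le_trans (Hd _ jl); rewrite lerD2l ge_min lexx.
exists l, d; split => // z Hz i il /=.
apply: lt_le_trans (Hd _ il).
have -> : z - x = (y - x) + (z - y) by rewrite [RHS]addrC addrA subrK.
by apply: (le_lt_trans (seminormD (hP i) _ _)); rewrite ltrD2l Hz.
Qed.

Lemma seminorm_nbhs_nbhs x A :
  seminorm_nbhs x A -> seminorm_nbhs x (seminorm_nbhs^~ A).
Proof.
move=> [l [e [e0 H]]]; exists l, e; split => // y Hy.
have [_ _ S] := @filter_filter _ _ (seminorm_nbhs_filter y).
by apply: S (seminorm_nbhs_ball Hy e0) => z /H.
Qed.

Lemma seminorm_nbhs_add x y A : seminorm_nbhs (x + y) A ->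
  exists B C, [/\ seminorm_nbhs x B, seminorm_nbhs y C &
    forall b c, B b -> C c -> A (b + c)].
Proof.
move=> [l [e [e0 H]]].
exists [set b | forall i, i \in l -> P i (b - x) < e / 2].
exists [set c | forall i, i \in l -> P i (c - y) < e / 2].
split; [by exists l, (e / 2); split; rewrite ?divr_gt0..|].
move=> b c Bb Cc; apply: H => i il.
rewrite opprD addrACA; apply: (le_lt_trans (seminormD (hP i) _ _)).
by rewrite (splitr e) ltrD ?Bb ?Cc.
Qed.

Lemma seminorm_nbhs_scale (a : K) x A : seminorm_nbhs (a *: x) A ->
  exists (d : R) B, [/\ 0 < d, seminorm_nbhs x B &
    forall b y, modulus (a - b) < d -> B y -> A (b *: y)].
Proof.
move=> [l [e [e0 H]]].
have [M M0 HM] : exists2 M, 0 < M & forall i, i \in l -> P i x <= M.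
  elim: l {H} => [|i l [M M0 HM]]; first by exists 1.
  exists (Num.max M (P i x)); first by rewrite lt_max M0.
  move=> j; rewrite inE => /predU1P[->|/HM]; first by rewrite le_max lexx orbT.
  by move=> /le_trans; apply; rewrite le_max lexx.
pose d := Num.min 1 (e / 2 / M); pose N := 1 + modulus a.
have N0 : 0 < N by rewrite ltr_pwDl// modulus_ge0.
have d0 : 0 < d by rewrite lt_min ltr01 !divr_gt0.
exists d, [set y | forall i, i \in l -> P i (y - x) < e / 2 / N]; split => //.
  by exists l, (e / 2 / N); split => //; rewrite !divr_gt0.
move=> b y abd By; apply: H => i il.
have -> : b *: y - a *: x = b *: (y - x) - (a - b) *: x.
  by rewrite scalerBr scalerBl opprB addrA subrK.
apply: (le_lt_trans (seminormB _ _ (hP i))).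
rewrite !(seminormZ (hP i)) (splitr e) ltr_leD//.
  have [->|Py] := eqVneq (P i (y - x)) 0; first by rewrite mulr0 divr_gt0.
  have {}Py : 0 < P i (y - x) by rewrite lt_def Py (seminorm_ge0 (hP i)).
  apply: (@le_lt_trans _ _ (N * P i (y - x))).
    apply: ler_wpM2r; first exact: ltW.
    rewrite -[b](subrK a) (le_trans (modulusD _ _))// /N lerD2r.
    by rewrite -modulusN opprB (le_trans (ltW abd))// ge_min lexx.
  by rewrite -ltr_pdivlMl// mulrC By.
apply: (@le_trans _ _ (d * M)).
  by apply: ler_pM; rewrite ?modulus_ge0 ?(seminorm_ge0 (hP i)) ?HM ?(ltW abd).
by rewrite -ler_pdivlMr// ge_min lexx orbT.
Qed.

End SeminormNbhs.

End Seminorms.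

Section PowerSeries.
Context {R : realType} {s : scalars}.
Local Notation K := (scalar_field R s).
Implicit Types (E : nat -> R) (r : R).

Definition ps_sqnorm E r (xi : nat -> K) : \bar R :=
  (\sum_(0 <= n <oo) (modulus (xi n) ^+ 2 * expR (2 * r * E n))%:E)%E.

Definition ps_mem E : {pred (nat -> K^o)} :=
  fun xi => `[< forall r, r < 1 -> (ps_sqnorm E r xi < +oo)%E >].

Lemma ps_sqnorm_ge0 E r xi : (0 <= ps_sqnorm E r xi)%E.
Proof.
by apply: nneseries_ge0 => n _ _; rewrite lee_fin mulr_ge0 ?sqr_ge0 ?expR_ge0.
Qed.

Lemma ps_sqnorm0 E r : ps_sqnorm E r (fun=> 0) = 0%E.
Proof. by apply: eseries0 => n _ _; rewrite modulus0 expr0n/= mul0r. Qed.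

Lemma ps_sqnormZ E r (a : K) xi :
  ps_sqnorm E r (fun n => a * xi n) = ((modulus a ^+ 2)%:E * ps_sqnorm E r xi)%E.
Proof.
rewrite /ps_sqnorm -nneseriesZl; last by move=> n _; rewrite lee_fin mulr_ge0 ?sqr_ge0 ?expR_ge0.
by apply: eq_eseriesr => n _; rewrite modulusM exprMn -[(_ * _ * expR _)%R]mulrA EFinM.
Qed.

Lemma sqrD_convex (t a b : R) : 0 < t < 1 ->
  (a + b) ^+ 2 <= a ^+ 2 / t + b ^+ 2 / (1 - t).
Proof.
move=> /andP[t0 t1]; have u0 : 0 < 1 - t by rewrite subr_gt0.
rewrite -subr_ge0.
have -> : a ^+ 2 / t + b ^+ 2 / (1 - t) - (a + b) ^+ 2 =
    (a * (1 - t) - b * t) ^+ 2 / (t * (1 - t)).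
  by field; rewrite !gt_eqF.
by rewrite divr_ge0 ?sqr_ge0// mulr_ge0 ?ltW.
Qed.

Lemma ps_sqnormD E r t (xi eta : nat -> K) : 0 < t < 1 ->
  (ps_sqnorm E r (fun n => (xi n + eta n)%R) <=
   (t^-1)%:E * ps_sqnorm E r xi + ((1 - t)^-1)%:E * ps_sqnorm E r eta)%E.
Proof.
move=> t01; have /andP[t0 t1] := t01.
have u0 : 0 < 1 - t by rewrite subr_gt0.
have pos (z : nat -> K) n : (0 <= (modulus (z n) ^+ 2 * expR (2 * r * E n))%:E)%E.
  by rewrite lee_fin mulr_ge0 ?sqr_ge0 ?expR_ge0.
rewrite /ps_sqnorm -!nneseriesZl; [|by move=> n _; exact: pos..].
rewrite -nneseriesD; last 2 first.
- by move=> n _ _; rewrite mule_ge0 ?pos// lee_fin invr_ge0 ltW.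
- by move=> n _ _; rewrite mule_ge0 ?pos// lee_fin invr_ge0 ltW.
apply: lee_nneseries => n _; first by move=> _; exact: (pos (fun n => xi n + eta n)).
have -> u v w : (u%:E * (v * w)%:E = (u * v * w)%:E :> \bar R)%E.
  by rewrite -EFinM mulrA.
have -> u v w : (u%:E * (v * w)%:E = (u * v * w)%:E :> \bar R)%E.
  by rewrite -EFinM mulrA.
rewrite -EFinD lee_fin -mulrDl.
apply: ler_wpM2r; first exact: expR_ge0.
rewrite ![_^-1 * _]mulrC; apply: le_trans (sqrD_convex _ _ t01).
by rewrite ler_sqr ?nnegrE ?addr_ge0 ?modulus_ge0 ?modulusD.
Qed.

Lemma ps_mem_submod_closed E : submod_closed (ps_mem E).
Proof.
split; first by apply/asboolP => r _; rewrite ps_sqnorm0 ltry.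
move=> a xi eta /asboolP hxi /asboolP heta; apply/asboolP => r r1.
have h2 : 0 < (2^-1 : R) < 1 by rewrite invr_gt0 ltr0n invf_lt1 ?ltr1n ?ltr0n.
have := ps_sqnormD E r (fun n => a * xi n) eta h2.
rewrite ps_sqnormZ => /le_lt_trans; apply.
have c0 : (0 <= 1 - 2^-1 :> R)%R by rewrite subr_ge0 ltW; case/andP: h2.
by rewrite lte_add_pinfty ?lte_mul_pinfty ?hxi ?heta ?lee_fin ?invr_ge0 ?sqr_ge0.
Qed.

HB.instance Definition _ E :=
  GRing.isSubmodClosed.Build K (nat -> K^o) (ps_mem E) (ps_mem_submod_closed E).

Record power_series E := PowerSeries {
  coefs :> nat -> K^o ;
  coefs_mem : coefs \in ps_mem E
}.

HB.instance Definition _ E := [isSub for @coefs E].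
HB.instance Definition _ E := [Choice of power_series E by <:].
HB.instance Definition _ E :=
  [SubChoice_isSubLmodule of power_series E by <:].

Definition ps_norm E r (xi : power_series E) : R :=
  Num.sqrt (fine (ps_sqnorm E r xi)).

Lemma ps_sqnorm_fin E r (xi : power_series E) :
  r < 1 -> ps_sqnorm E r xi \is a fin_num.
Proof.
by move=> r1; have /asboolP/(_ _ r1) h := coefs_mem xi; rewrite ge0_fin_numE ?ps_sqnorm_ge0.
Qed.

Lemma ps_norm_seminorm E r : r < 1 -> seminorm (@ps_norm E r).
Proof.
move=> r1; split => [x|x y|a x].
- exact: sqrtr_ge0.
- have fx := ps_sqnorm_fin x r1; have fy := ps_sqnorm_fin y r1.
  have fxy := ps_sqnorm_fin (x + y) r1.
  set u := ps_norm r x; set v := ps_norm r y.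
  have u0 : 0 <= u by exact: sqrtr_ge0.
  have v0 : 0 <= v by exact: sqrtr_ge0.
  have sqE (z : power_series E) : fine (ps_sqnorm E r z) = ps_norm r z ^+ 2.
    by rewrite sqr_sqrtr// fine_ge0// ps_sqnorm_ge0.
  have main t : 0 < t < 1 -> ps_norm r (x + y) ^+ 2 <= u ^+ 2 / t + v ^+ 2 / (1 - t).
    move=> t01; have := ps_sqnormD E r x y t01.
    rewrite -(fineK fx) -(fineK fy) -[X in (X <= _)%E](fineK fxy).
    by rewrite -!EFinM -EFinD lee_fin !sqE ![_^-1 * _]mulrC.
  apply/ler_addgt0Pl => e e0.
  pose u' := u + e / 2; pose v' := v + e / 2.
  have e2 : 0 < e / 2 by rewrite divr_gt0.
  have u'0 : 0 < u' by rewrite ltr_wpDl.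
  have v'0 : 0 < v' by rewrite ltr_wpDl.
  have w0 : 0 < u' + v' by rewrite addr_gt0.
  have -> : e + (u + v) = u' + v' by rewrite /u' /v' addrACA -splitr addrC.
  rewrite -ler_sqr ?nnegrE ?sqrtr_ge0 ?(ltW w0)//.
  have t01 : 0 < u' / (u' + v') < 1.
    by rewrite divr_gt0//= ltr_pdivrMr// mul1r ltrDl.
  apply: (le_trans (main _ t01)).
  have -> : 1 - u' / (u' + v') = v' / (u' + v') by field; rewrite gt_eqF.
  have -> : (u' + v') ^+ 2 =
      u' ^+ 2 / (u' / (u' + v')) + v' ^+ 2 / (v' / (u' + v')).
    by field; rewrite !gt_eqF.
  have sq (a b : R) : 0 <= a -> a <= a + b -> a ^+ 2 <= (a + b) ^+ 2.
    by move=> a0 ab; rewrite ler_sqr// nnegrE// (le_trans a0).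
  apply: lerD; apply: ler_wpM2r.
  - by rewrite invr_ge0 divr_ge0 ?ltW.
  - by apply: sq => //; rewrite lerDl ltW.
  - by rewrite invr_ge0 divr_ge0 ?ltW.
  - by apply: sq => //; rewrite lerDl ltW.
- rewrite /ps_norm [ps_sqnorm E r (a *: x)]ps_sqnormZ.
  rewrite fineM// ?ps_sqnorm_fin//= sqrtrM ?sqr_ge0// sqrtr_sqr ger0_norm//.
  exact: modulus_ge0.
Qed.

Let nrm E (i : {r : R | r < 1}) := @ps_norm E (val i).

Let nrm_seminorm E i : seminorm (@nrm E i).
Proof. exact: ps_norm_seminorm (valP i). Qed.

HB.instance Definition _ E :=
  hasNbhs.Build (power_series E) (seminorm_nbhs (@nrm E)).

HB.instance Definition _ E := Nbhs_isNbhsTopological.Build (power_series E)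
  (seminorm_nbhs_filter (@nrm_seminorm E))
  (seminorm_nbhs_singleton (@nrm_seminorm E))
  (seminorm_nbhs_nbhs (@nrm_seminorm E)).

Let ps_add_continuous E :
  continuous (fun x : power_series E * power_series E => x.1 + x.2).
Proof.
move=> [x y] A /(seminorm_nbhs_add (@nrm_seminorm E))[B [C [xB yC BCA]]].
by exists (B, C) => // -[b c] [/= Bb Cc]; exact: BCA.
Qed.

Let ps_scale_continuous E :
  continuous (fun z : K^o * power_series E => z.1 *: z.2).
Proof.
move=> [a x] A /(seminorm_nbhs_scale (@nrm_seminorm E))[d [B [d0 xB BA]]].
exists (ball a (of_real d : K), B).
  by split => //=; apply: nbhsx_ballx; rewrite -(rmorph0 of_real) ltr_of_real.
move=> [b y] [/= ab By]; apply: BA => //.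
by move: ab; rewrite -ball_normE/= normr_modulus ltr_of_real.
Qed.

Let convR (m a b e : R) : 0 < m -> 0 <= 1 - m -> a < e -> b < e ->
  m * a + (1 - m) * b < e.
Proof.
move=> m0 m1 ae be; rewrite (_ : e = m * e + (1 - m) * e).
  by rewrite ltr_leD ?ltr_pM2l// ler_wpM2l// ltW.
by rewrite -mulrDl [m + _]addrC subrK mul1r.
Qed.

Let ps_ball_convex E i (x y z : power_series E) (c : K) (e : R) :
  0 < c -> c < 1 -> nrm i (y - x) < e -> nrm i (z - x) < e ->
  nrm i (c *: y + (1 - c) *: z - x) < e.
Proof.
move=> k0 k1 hy hz.
have c0 : 0 < modulus c.
  by rewrite -(@ltr_of_real R s) -normr_modulus rmorph0 normr_gt0 gt_eqF.
have c1 : modulus (1 - c) = 1 - modulus c.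
  apply: (@of_real_inj R s); rewrite rmorphB/= rmorph1 -!normr_modulus.
  by rewrite !gtr0_norm// subr_gt0.
have -> : c *: y + (1 - c) *: z - x = c *: (y - x) + (1 - c) *: (z - x).
  by rewrite !scalerBr addrACA -opprD -scalerDl [c + _]addrC subrK scale1r.
apply: (le_lt_trans (seminormD (nrm_seminorm _ _) _ _)).
rewrite !(seminormZ (nrm_seminorm _ _)) c1.
have d0 : 0 <= 1 - modulus c by rewrite -c1 modulus_ge0.
exact: convR c0 d0 hy hz.
Qed.

Let ps_locally_convex E : exists2 B : set_system (power_series E),
  (forall b, b \in B -> convex_set b) & basis B.
Proof.
exists [set U | exists (x : power_series E) (l : seq {r : R | r < 1}) (e : R),
    0 < e /\ U = [set z | forall i, i \in l -> nrm i (z - x) < e]].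
  move=> b /set_mem[x [l [e [e0 ->]]]]; apply/convex_setW => y z.
  move=> /set_mem/= hy /set_mem/= hz k k0 k1; apply/mem_set => i il.
  exact: ps_ball_convex (k0) (k1) (hy i il) (hz i il).
split.
  move=> _ [x [l [e [e0 ->]]]]; rewrite openE => y hy.
  exact: (seminorm_nbhs_ball (@nrm_seminorm E)).
move=> x A [l [e [e0 hA]]]; exists [set z | forall i, i \in l -> nrm i (z - x) < e] => //.
split; first by exists x, l, e.
by move=> i _; rewrite subrr (seminorm0 (nrm_seminorm _ _)).
Qed.

(* [PreTopologicalLmod_isTvs] only registers the uniform structure; the
   remaining instances have to be declared separately. *)
HB.instance Definition _ E := PreTopologicalLmod_isTvs.Build K (power_series E)
  (@ps_add_continuous E) (@ps_scale_continuous E) (@ps_locally_convex E).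
HB.instance Definition _ E :=
  PreTopologicalNmodule_isTopologicalNmodule.Build (power_series E)
    (@ps_add_continuous E).
HB.instance Definition _ E :=
  TopologicalNmodule_isTopologicalLmodule.Build K (power_series E)
    (@ps_scale_continuous E).
HB.instance Definition _ E :=
  Uniform_isTvs.Build K (power_series E) (@ps_locally_convex E).

End PowerSeries.

Section LocallyConvexSpaces.
Context {R : realType} {s : scalars}.
Local Notation K := (scalar_field R s).

(* Completeness is spelled out with the neighbourhoods of [0]: a [tvsType] comes
   with a uniformity that induces its topology, but that need not be the
   translation-invariant one. *)
Definition frechet (X : tvsType K) :=
  [/\ hausdorff_space X,
      exists V : nat -> set X, (forall n, nbhs (0 : X) (V n)) /\
        forall U, nbhs (0 : X) U -> exists n, V n `<=` U &
      forall F : set_system X, ProperFilter F ->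
        (forall U, nbhs (0 : X) U ->
           exists2 A, F A & forall x y, A x -> A y -> U (x - y)) ->
        exists x : X, F --> x].

Definition continuous_seminorm (X : tvsType K) (p : X -> R) :=
  seminorm p /\ continuous p.

(* Every continuous seminorm [p] is dominated by a continuous seminorm [q] for
   which the canonical map [X / ker q -> X / ker p] between the associated
   normed spaces is nuclear: it is
   [x |-> \sum_n c n *: f n x *: y n] with [c] absolutely summable,
   [f n] of dual norm at most 1 for [q] and [p (y n) <= 1]. *)
Definition nuclear (X : tvsType K) :=
  forall p : X -> R, continuous_seminorm p ->
  exists2 q : X -> R, continuous_seminorm q & (forall x, p x <= q x) /\
  exists (c : nat -> K) (f : nat -> {scalar X}) (y : nat -> X),
    [/\ cvgn (series (fun n => modulus (c n))),
        forall n x, modulus (f n x) <= q x,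
        forall n, p (y n) <= 1 &
        forall x, p (x - \sum_(0 <= n < N) (c n * f n x) *: y n)
                    @[N --> \oo] --> (0 : R)].

Definition tvs_bounded (X : tvsType K) (B : set X) :=
  forall U, nbhs (0 : X) U ->
  exists2 lam : R, 0 < lam & B `<=` [set of_real lam *: u | u in U].

Definition linear_subspace (V : lmodType K) (L : set V) :=
  L 0 /\ forall (a : K) x y, L x -> L y -> L (a *: x + y).

Definition dim_le (V : lmodType K) (n : nat) (L : set V) :=
  exists e : 'I_n -> V, forall x, L x ->
  exists a : 'I_n -> K, x = \sum_i a i *: e i.

Definition kolmogorov_diam (V : lmodType K) (n : nat) (B U : set V) : \bar R :=
  ereal_inf [set ereal_inf [set lam%:E | lam in
        [set lam : R | 0 < lam /\
           B `<=` [set of_real lam *: u + w | u in U & w in L]]]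
    | L in [set L | linear_subspace L /\ dim_le n L]].

Definition approx_diametral_dim (X : tvsType K) : set (nat -> K) :=
  [set t | exists (U B : set X),
    [/\ nbhs (0 : X) U, tvs_bounded B,
        forall n, (0 < kolmogorov_diam n B U)%E &
        t n / of_real (fine (kolmogorov_diam n B U)) @[n --> \oo] --> (0 : K)]].

Definition closed_unit_ball (V : lmodType K) (p : V -> R) : set V :=
  [set x | p x <= 1].

Section Gradings.
Context {X : tvsType K} (nrm : nat -> X -> R).
Let U k := closed_unit_ball (nrm k).

Definition hilbertian_grading :=
  [/\ forall k, hilbertian_norm (nrm k),
      forall k x, nrm k x <= nrm k.+1 x &
      forall A, nbhs (0 : X) A <->
        exists k (e : R), 0 < e /\ [set x | nrm k x < e] `<=` A].

Definition underlined_DN :=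
  forall k, exists lam C : R, [/\ 0 < lam < 1, 0 < C &
    forall x, nrm k.+1 x <= C * nrm k x `^ lam * nrm k.+2 x `^ (1 - lam)].

Definition property_Omega :=
  forall k p, exists (C : R) (j : nat), 0 < C /\
    forall r : R, 0 < r ->
      U k.+1 `<=` [set of_real (C * r ^+ j) *: u + of_real r^-1 *: v
                  | u in U p & v in U k].

(* [+oo] when the diameter vanishes. *)
Definition diam_exponent (p q n : nat) : \bar R :=
  (- lne (kolmogorov_diam n (U q) (U p)))%E.

End Gradings.

Definition local_imbedding (X : tvsType K) (E : nat -> R) (r : R)
    (T : {linear power_series (s := s) E -> X}) :=
  continuous T /\
  exists2 p : X -> R, continuous_seminorm p &
  exists2 C : R, 0 < C & forall x, C * ps_norm r x <= p (T x).

End LocallyConvexSpaces.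

(* Main.v *)
(* With S the set of the sequences t such that |t_n| <= e^{-d E_n} eventually, for some
   d > 0, the unit balls of the norms |.|_r give delta(Lambda_1(E)) = S, and DN gives
   delta(X) <= S by induction along the grading; assertion (1) thus says S <= delta(X).

   Kolmogorov diameters are handled through finite-dimensional subspaces of X.  For a
   Hilbertian norm p, an (n+1)-dimensional subspace on which d q <= p forces
   d_n(U_q, U_p) >= d.  Conversely, a system of n+1 vectors of U_q with almost maximal
   Gram determinant for p spans a subspace on which q <= 2 (n+1)^2 / d_n(U_q, U_p) p; the
   polynomial factor is harmless because n = O(e^{d E_n}) for all d > 0, by nuclearity.

   (1) => (2): e^{-eps E_n} is in delta(X), and every bounded set lies in a multiple of
   each U_q.
   (2) => (3): by the above there are (n+1)-dimensional subspaces on which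
   |.|_q <= C_q e^{2 eps E_n} |.|_p.  Letting q grow slowly with n and choosing in the n-th
   subspace a vector orthogonal for |.|_p to its predecessors yields a |.|_p-orthonormal
   sequence (g_n) with |g_n|_q = O(e^{3 eps E_n}) for all q; then
   T xi = sum_n xi_n e^{r E_n} g_n is an r-local imbedding.
   (3) => (1): the image under T of the unit ball of |.|_1 is a bounded set whose
   diameters are at least c e^{-(1 - r) E_n}. *)
Require Import Defs.
From HB Require Import structures.
From mathcomp Require Import all_boot all_order perm all_algebra.
From mathcomp Require Import complex.
From mathcomp Require Import ring lra.
From mathcomp Require Import all_classical all_reals all_analysis.

Set Implicit Arguments.
Unset Strict Implicit.
Unset Printing Implicit Defensive.

Import Order.TTheory GRing.Theory Num.Theory.
Import numFieldNormedType.Exports.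

Local Open Scope classical_set_scope.
Local Open Scope ring_scope.

(** * Scalars and semi-inner products *)

Section Conjugate.
Context {R : realType} {s : scalars}.
Local Notation K := (scalar_field R s).
Implicit Types (z w : K) (x : R).

Lemma conjugateD z w : conjugate (z + w) = conjugate z + conjugate w.
Proof. by case: s z w => //= z w; rewrite rmorphD. Qed.

Lemma conjugateM z w : conjugate (z * w) = conjugate z * conjugate w.
Proof. by case: s z w => //= z w; rewrite rmorphM. Qed.

Lemma conjugateK z : conjugate (conjugate z) = z.
Proof. by case: s z => //= z; rewrite conjcK. Qed.

Lemma mul_conjugate z : z * conjugate z = of_real (modulus z ^+ 2).
Proof.
rewrite rmorphXn/= -normr_modulus; case: s z => /= z; last by rewrite sqr_normc.
by rewrite real_normK ?num_real.
Qed.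

Lemma conjugate_of_real x : conjugate (of_real x : K) = of_real x.
Proof. by case: s => //=; exact: conjc_real. Qed.

Lemma conjugate0 : conjugate (0 : K) = 0.
Proof. by rewrite -(rmorph0 (of_real : {rmorphism R -> K})) conjugate_of_real. Qed.

Lemma modulus1 : modulus (1 : K) = 1.
Proof. by rewrite -(rmorph1 (of_real : {rmorphism R -> K})) modulus_of_real normr1. Qed.

Lemma modulus_eq0 z : (modulus z == 0) = (z == 0).
Proof. by rewrite -(inj_eq (@of_real_inj R s)) rmorph0 -normr_modulus normr_eq0. Qed.

Lemma modulusV z : modulus z^-1 = (modulus z)^-1.
Proof. by apply: (@of_real_inj R s); rewrite -normr_modulus normfV normr_modulus fmorphV. Qed.

Lemma modulus_sum (I : Type) (r : seq I) (P : pred I) (F : I -> K) :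
  modulus (\sum_(i <- r | P i) F i) <= \sum_(i <- r | P i) modulus (F i).
Proof.
elim/big_rec2: _ => [|i y x _ yx]; first by rewrite modulus0.
by rewrite (le_trans (modulusD _ _))// lerD2l.
Qed.

Lemma modulus_prod (I : Type) (r : seq I) (P : pred I) (F : I -> K) :
  modulus (\prod_(i <- r | P i) F i) = \prod_(i <- r | P i) modulus (F i).
Proof. exact: (big_morph _ (@modulusM R s) modulus1). Qed.

End Conjugate.

Section SemiInner.
Context {R : realType} {s : scalars}.
Local Notation K := (scalar_field R s).
Context {V : lmodType K}.
Implicit Types (x y z : V) (a : K).

(** [N] stands for the square of the norm. Definiteness is kept as a separate assumption, so that
    forms seeing only finitely many coordinates are covered. *)
Record semi_inner (h : V -> V -> K) (N : V -> R) : Prop := {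
  semi_inner_linear : forall a x y z, h (a *: x + y) z = a * h x z + h y z ;
  semi_innerC : forall x y, h y x = conjugate (h x y) ;
  semi_inner_diag : forall x, h x x = of_real (N x) ;
  semi_inner_ge0 : forall x, 0 <= N x
}.

Context (h : V -> V -> K) (N : V -> R).
Hypothesis hN : semi_inner h N.

Lemma semi_inner0l y : h 0 y = 0.
Proof.
have := semi_inner_linear hN 1 0 0 y; rewrite scaler0 addr0 mul1r => /eqP.
by rewrite -subr_eq subrr eq_sym => /eqP.
Qed.

Lemma semi_innerDl x y z : h (x + y) z = h x z + h y z.
Proof. by rewrite -[x]scale1r (semi_inner_linear hN) mul1r scale1r. Qed.

Lemma semi_innerZl a x z : h (a *: x) z = a * h x z.
Proof. by rewrite -[_ *: _]addr0 (semi_inner_linear hN) semi_inner0l addr0. Qed.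

Lemma semi_innerBl x y z : h (x - y) z = h x z - h y z.
Proof. by rewrite semi_innerDl -scaleN1r semi_innerZl mulN1r. Qed.

Lemma semi_inner_suml (I : Type) (r : seq I) (a : I -> K) (x : I -> V) z :
  h (\sum_(i <- r) a i *: x i) z = \sum_(i <- r) a i * h (x i) z.
Proof.
elim: r => [|i r IH]; first by rewrite !big_nil semi_inner0l.
by rewrite !big_cons (semi_inner_linear hN) IH.
Qed.

Lemma semi_innerDr x y z : h x (y + z) = h x y + h x z.
Proof. by rewrite !(semi_innerC hN _ x) semi_innerDl conjugateD. Qed.

Lemma semi_innerZr a x z : h x (a *: z) = conjugate a * h x z.
Proof. by rewrite !(semi_innerC hN _ x) semi_innerZl conjugateM. Qed.

Lemma semi_inner0r x : h x 0 = 0.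
Proof. by rewrite (semi_innerC hN 0) semi_inner0l conjugate0. Qed.

Lemma semi_inner_sumr (I : Type) (r : seq I) (a : I -> K) (x : I -> V) z :
  h z (\sum_(i <- r) a i *: x i) = \sum_(i <- r) conjugate (a i) * h z (x i).
Proof.
elim: r => [|i r IH]; first by rewrite !big_nil semi_inner0r.
by rewrite !big_cons semi_innerDr semi_innerZr IH.
Qed.

Lemma semi_inner_pythagoras x y : h x y = 0 -> N (x + y) = N x + N y.
Proof.
move=> xy; apply: (@of_real_inj R s).
rewrite -(semi_inner_diag hN) semi_innerDl !semi_innerDr (semi_innerC hN x y) xy.
by rewrite conjugate0 addr0 add0r !(semi_inner_diag hN) rmorphD.
Qed.

Lemma semi_inner_normZ a x : N (a *: x) = modulus a ^+ 2 * N x.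
Proof.
apply: (@of_real_inj R s).
rewrite -(semi_inner_diag hN) semi_innerZl semi_innerZr mulrA mul_conjugate.
by rewrite (semi_inner_diag hN) rmorphM.
Qed.

Hypothesis definite : forall x, N x = 0 -> x = 0.

(** Pythagoras for [x = (x - c *: y) + c *: y] with [c = h x y / N y], the two summands being
    orthogonal. *)
Lemma cauchy_schwarz x y : modulus (h x y) ^+ 2 <= N x * N y.
Proof.
have [/definite->|Ny] := eqVneq (N y) 0.
  by rewrite semi_inner0r modulus0 expr0n mulr_ge0 ?(semi_inner_ge0 hN).
have {}Ny : 0 < N y by rewrite lt_def Ny (semi_inner_ge0 hN).
pose c := h x y / of_real (N y).
have xcy : h (x - c *: y) (c *: y) = 0.
  rewrite semi_innerBl !semi_innerZr semi_innerZl (semi_inner_diag hN) /c divfK ?subrr//.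
  by rewrite -(rmorph0 (of_real : {rmorphism R -> K})) (inj_eq (@of_real_inj R s)) gt_eqF.
have /(f_equal (fun u => u * N y)) := semi_inner_pythagoras xcy.
rewrite subrK mulrDl => ->.
rewrite semi_inner_normZ /c modulusM modulusV modulus_of_real (gtr0_norm Ny).
have -> : (modulus (h x y) / N y) ^+ 2 * N y * N y = modulus (h x y) ^+ 2.
  by field; rewrite gt_eqF.
by rewrite lerDr mulr_ge0 ?(semi_inner_ge0 hN).
Qed.

(** Gram-Schmidt by induction: [w] and [x'] are the residuals of [e ord0] and [x] modulo the other
    vectors, and only the component of [x'] along [w] remains to be removed. If [w = 0], the vectors
    are dependent and [e ord0] gets coefficient 0. *)
Lemma orthogonal_projection n (e : 'I_n -> V) x :
  exists a : 'I_n -> K, forall j, h (x - \sum_i a i *: e i) (e j) = 0.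
Proof.
elim: n e x => [|n IH] e x; first by exists (fun=> 0) => -[].
pose e' i := e (lift ord0 i).
have [b hb] := IH e' (e ord0); have [a ha] := IH e' x.
set w := e ord0 - _ in hb; set x' := x - _ in ha.
have e0 : e ord0 = w + \sum_i b i *: e' i by rewrite subrK.
have x'e0 : h x' (e ord0) = h x' w.
  rewrite e0 semi_innerDr semi_inner_sumr big1 ?addr0// => i _.
  by rewrite ha mulr0.
have [w0|Nw] := eqVneq w 0.
  exists (fun i => oapp a 0 (unlift ord0 i)) => j.
  rewrite big_ord_recl unlift_none/= scale0r add0r.
  under eq_bigr do rewrite liftK/=.
  rewrite -/x'; case: (unliftP ord0 j) => [i ->|->]; first exact: ha.
  by rewrite x'e0 w0 semi_inner0r.
have {}Nw : N w != 0 by apply: contra_neq Nw; exact: definite.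
pose c := h x' w / of_real (N w).
exists (fun i => oapp (fun i => a i - c * b i) c (unlift ord0 i)) => j.
rewrite big_ord_recl unlift_none/=.
under eq_bigr do rewrite liftK/= scalerBl -scalerA.
rewrite sumrB -scaler_sumr.
have -> : x - (c *: e ord0 + (\sum_i a i *: e (lift ord0 i) -
    c *: \sum_i b i *: e (lift ord0 i))) = x' - c *: w.
  by rewrite /x' /w scalerBr !opprD !opprK !addrA [x - _ - _]addrAC.
case: (unliftP ord0 j) => [i ->|->].
  by rewrite semi_innerBl semi_innerZl ha hb mulr0 subrr.
rewrite e0 semi_innerDr semi_inner_sumr big1 ?addr0; last first.
  by move=> i _; rewrite semi_innerBl semi_innerZl ha hb mulr0 subrr mulr0.
rewrite semi_innerBl semi_innerZl (semi_inner_diag hN) /c divfK ?subrr//.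
by rewrite -(rmorph0 (of_real : {rmorphism R -> K})) (inj_eq (@of_real_inj R s)).
Qed.

End SemiInner.

(** * Kolmogorov diameters in spaces with a Hilbertian norm *)

Section KolmogorovDiameter.
Context {R : realType} {s : scalars}.
Local Notation K := (scalar_field R s).
Context {V : lmodType K}.
Implicit Types (B U L : set V) (n : nat).

Lemma kolmogorov_diam_lb n B U (d : \bar R) :
    (forall L (lam : R), linear_subspace L -> dim_le n L -> 0 < lam ->
      B `<=` [set of_real lam *: u + w | u in U & w in L] -> (d <= lam%:E)%E) ->
  (d <= kolmogorov_diam n B U)%E.
Proof.
move=> H; apply/le_ereal_inf_tmp => _ [L [Ls Ld] <-].
by apply/le_ereal_inf_tmp => _ [lam [lam0 BU] <-]; exact: H BU.
Qed.

Lemma kolmogorov_diam_ub n B U L (lam : R) : linear_subspace L -> dim_le n L ->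
    0 < lam -> B `<=` [set of_real lam *: u + w | u in U & w in L] ->
  (kolmogorov_diam n B U <= lam%:E)%E.
Proof.
move=> Ls Ld lam0 BU; apply: ge_ereal_inf.
exists (ereal_inf [set mu%:E | mu in [set mu : R | 0 < mu /\
    B `<=` [set of_real mu *: u + w | u in U & w in L]]]); first by exists L.
by apply: ereal_inf_lbound; exists lam.
Qed.

Lemma kolmogorov_diam_ge0 n B U : (0 <= kolmogorov_diam n B U)%E.
Proof. by apply: kolmogorov_diam_lb => L lam _ _ /ltW; rewrite lee_fin. Qed.

Lemma dim_leS n L : dim_le n L -> dim_le n.+1 L.
Proof.
move=> [e he]; exists (fun i => oapp e 0 (unlift ord0 i)) => x /he[a ->].
exists (fun i => oapp a 0 (unlift ord0 i)).
rewrite big_ord_recl unlift_none scaler0 add0r.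
by apply: eq_bigr => i _; rewrite liftK.
Qed.

Lemma kolmogorov_diam_nonincreasing B U m n : (m <= n)%N ->
  (kolmogorov_diam n B U <= kolmogorov_diam m B U)%E.
Proof.
elim: n => [|n IH]; first by rewrite leqn0 => /eqP->.
rewrite leq_eqVlt ltnS => /predU1P[->//|/IH]; apply: le_trans.
apply: kolmogorov_diam_lb => L lam Ls /dim_leS Ld lam0.
exact: kolmogorov_diam_ub.
Qed.

(** A covering of [B'] by [lam U' + L], multiplied by [c], covers [B] by [c c' lam U + L], since a
    subspace absorbs scalars. *)
Lemma kolmogorov_diam_scale n B B' U U' (c c' : R) : 0 < c -> 0 < c' ->
    (forall x, B x -> B' (of_real c^-1 *: x)) ->
    (forall u, U' u -> U (of_real c'^-1 *: u)) ->
  (kolmogorov_diam n B U <= (c * c')%:E * kolmogorov_diam n B' U')%E.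
Proof.
move=> c0 c'0 BB' U'U; have cc' : 0 < c * c' by rewrite mulr_gt0.
have [c1 c'1] : (of_real c : K) != 0 /\ (of_real c' : K) != 0.
  by rewrite !fmorph_eq0 !gt_eqF.
rewrite -lee_pdivrMl//; apply: kolmogorov_diam_lb => L lam Ls Ld lam0 BU.
rewrite lee_pdivrMl// -EFinM.
apply: (kolmogorov_diam_ub Ls Ld); first by rewrite mulr_gt0.
move=> x /BB'/BU[u Uu [w Lw] /(f_equal (fun y => of_real c *: y))].
rewrite [RHS]scalerA fmorphV divff// scale1r scalerDr scalerA => <-.
exists (of_real c'^-1 *: u); first exact: U'U.
exists (of_real c *: w).
  by have [L0 LD] := Ls; rewrite -[_ *: w]addr0; apply: LD.
congr (_ + _); rewrite scalerA -!rmorphM; congr (of_real _ *: _).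
by field; rewrite gt_eqF.
Qed.

Lemma kolmogorov_diam_mono n B B' U U' : B `<=` B' -> U' `<=` U ->
  (kolmogorov_diam n B U <= kolmogorov_diam n B' U')%E.
Proof.
move=> BB' U'U; rewrite -[leRHS]mul1e -[1 in leRHS](mulr1 1).
by apply: kolmogorov_diam_scale => // x; rewrite invr1 rmorph1 scale1r; [exact: BB'|exact: U'U].
Qed.

Lemma kolmogorov_diam_gt n B U L (d : R) : linear_subspace L -> dim_le n L -> 0 < d ->
  (d%:E < kolmogorov_diam n B U)%E ->
  exists2 x, B x & forall u w, U u -> L w -> x <> of_real d *: u + w.
Proof.
move=> Ls Ld d0 dK; apply: contrapT => H; move: dK; apply/negP; rewrite -leNgt.
apply: (kolmogorov_diam_ub Ls Ld d0) => x Bx; apply: contrapT => xUL.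
apply: H; exists x => // u w Uu Lw xE; apply: xUL.
by exists u => //; exists w.
Qed.

Lemma linear_subspace_span n (e : 'I_n -> V) :
  linear_subspace [set w | exists a : 'I_n -> K, w = \sum_i a i *: e i].
Proof.
split; first by exists (fun=> 0); rewrite big1// => i _; rewrite scale0r.
move=> c _ _ [a ->] [b ->]; exists (fun i => c * a i + b i).
rewrite scaler_sumr -big_split/=; apply: eq_bigr => i _.
by rewrite scalerDl scalerA.
Qed.

(** The matrix of the [h (x i) (e j)] has [n.+1] rows and rank at most [n], hence a nonzero vector
    in its left kernel. *)
Lemma span_orthogonal n (h : V -> V -> K) (N : V -> R) (x : 'I_n.+1 -> V) (e : 'I_n -> V) :
    semi_inner h N ->
  exists a, (exists i, a i != 0) /\ forall j, h (\sum_i a i *: x i) (e j) = 0.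
Proof.
move=> hN; pose M : 'M[K]_(n.+1, n) := \matrix_(i, j) h (x i) (e j).
have [v /sub_kermxP vM v0] : exists2 v : 'rV_n.+1, (v <= kermx M)%MS & v != 0.
  apply/rowV0Pn; rewrite -mxrank_eq0 mxrank_ker subn_eq0 -ltnNge ltnS.
  exact: rank_leq_col.
exists (v 0); split; first by have /rV0Pn := v0.
move=> j; rewrite (semi_inner_suml hN); have /matrixP/(_ 0 j) := vM.
rewrite !mxE => vMj; rewrite -[RHS]vMj.
by apply: eq_bigr => i _; rewrite !mxE.
Qed.

(* Some nonzero vector in the span of the n+1 vectors x is orthogonal to a given
   n-dimensional L, so that L does not help to approximate it. *)
Lemma kolmogorov_diam_ge n (h : V -> V -> K) (N p : V -> R) (x : 'I_n.+1 -> V)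
    B (d : R) : semi_inner h N -> seminorm p -> (forall y, N y <= p y ^+ 2) -> 0 < d ->
    (forall a, N (\sum_i a i *: x i) = 0 -> forall i, a i = 0) ->
    (forall a, N (\sum_i a i *: x i) <= d ^+ 2 -> B (\sum_i a i *: x i)) ->
  (d%:E <= kolmogorov_diam n B (closed_unit_ball p))%E.
Proof.
move=> hN hp Np d0 xfree xB; apply: kolmogorov_diam_lb => L lam Ls [e he] lam0 BL.
have [v [[i0 v0] ye]] := span_orthogonal x e hN.
set y := \sum_i _ in ye.
have Ny : 0 < N y.
  rewrite lt_def (semi_inner_ge0 hN) andbT; by apply: contra_neq v0 => /xfree/(_ i0).
pose c : R := d / Num.sqrt (N y).
have Nc : N (of_real c *: y) = d ^+ 2.
  rewrite (semi_inner_normZ hN) modulus_of_real real_normK ?num_real// expr_div_n.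
  by rewrite sqr_sqrtr ?ltW// divfK ?gt_eqF.
have cyE : of_real c *: y = \sum_i (of_real c * v i) *: x i.
  by rewrite scaler_sumr; apply: eq_bigr => i _; rewrite scalerA.
have /BL[u Uu [w Lw yE]] : B (of_real c *: y).
  by rewrite cyE; apply: xB; rewrite -cyE Nc.
(* Orthogonality to [w] turns [of_real c *: y = of_real lam *: u + w] into
   [N (of_real lam *: u) = d ^+ 2 + N (- w)], which bounds [lam] from below because [p u <= 1]. *)
have yw : h (of_real c *: y) (- 1 *: w) = 0.
  have [b ->] := he _ Lw.
  rewrite (semi_innerZr hN) (semi_innerZl hN) (semi_inner_sumr hN) big1 ?mulr0// => i _.
  by rewrite ye mulr0.
have := semi_inner_pythagoras hN yw.
rewrite scaleN1r -{1}yE addrK Nc => luE.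
rewrite lee_fin -(@ler_pXn2r _ 2) ?nnegrE ?(ltW d0) ?(ltW lam0)//.
have -> : lam ^+ 2 = p (of_real lam *: u) ^+ 2 + lam ^+ 2 * (1 - p u ^+ 2).
  rewrite (seminormZ hp) modulus_of_real (gtr0_norm lam0); ring.
rewrite -[leLHS]addr0 lerD//.
  by rewrite (le_trans _ (Np _))// luE lerDl (semi_inner_ge0 hN).
by rewrite mulr_ge0 ?sqr_ge0// subr_ge0 expr_le1// (seminorm_ge0 hp).
Qed.

End KolmogorovDiameter.

(** * Auerbach-type systems with almost maximal Gram determinant *)

Section AuerbachBasis.
Context {R : realType} {s : scalars}.
Local Notation K := (scalar_field R s).
Context {V : lmodType K} (h : V -> V -> K) (p : V -> R).
Hypotheses (hp : semi_inner h (fun x => p x ^+ 2)) (p_seminorm : seminorm p)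
  (p_definite : forall x, p x = 0 -> x = 0).
Context (B : set V) (M d : R) (n : nat).
Hypotheses (d_gt0 : 0 < d) (BM : forall x, B x -> p x <= M)
  (dB : (d%:E < kolmogorov_diam n B (closed_unit_ball p))%E).

Let gram m (x z : 'I_m -> V) : 'M[K]_m := \matrix_(i, j) h (x i) (z j).

Let p2_definite x : p x ^+ 2 = 0 -> x = 0.
Proof. by move=> /eqP; rewrite sqrf_eq0 => /eqP/p_definite. Qed.

Let cauchy_schwarz_le x z : p z <= 1 -> modulus (h x z) <= p x.
Proof.
move=> z1; rewrite -(@ler_pXn2r _ 2) ?nnegrE ?modulus_ge0 ?(seminorm_ge0 p_seminorm)//.
apply: (le_trans (cauchy_schwarz hp p2_definite _ _)).
by rewrite ler_piMr ?sqr_ge0// expr_le1// (seminorm_ge0 p_seminorm).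
Qed.

(** Some [x] in [B] has a residual [y] modulo the span of [e] with [p y > d]; then [z] is [y]
    normalized, and [h x z = p y]. *)
Let far_vector m (e : 'I_m -> V) : (m <= n)%N ->
  exists x z, [/\ B x, p z <= 1, forall j, h (e j) z = 0 & d <= modulus (h x z)].
Proof.
move=> mn; have dBm := lt_le_trans dB (kolmogorov_diam_nonincreasing _ _ mn).
have [|x Bx xNL] := kolmogorov_diam_gt (linear_subspace_span e) _ d_gt0 dBm.
  by exists e.
have [a ye] := orthogonal_projection hp p2_definite e x.
set w := \sum_i _ in ye; set y := x - w in ye.
have dy : d < p y.
  rewrite ltNge; apply/negP => yd.
  apply: (xNL (of_real d^-1 *: y) w); last 2 first.
  - by exists a.
  - by rewrite scalerA -rmorphM divff ?gt_eqF// rmorph1 scale1r subrK.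
  rewrite /closed_unit_ball/= (seminormZ p_seminorm) modulus_of_real.
  by rewrite gtr0_norm ?invr_gt0// ler_pdivrMl// mulr1.
have y0 : 0 < p y := lt_trans d_gt0 dy.
exists x, (of_real (p y)^-1 *: y); split => //.
- rewrite (seminormZ p_seminorm) modulus_of_real gtr0_norm ?invr_gt0//.
  by rewrite mulVf ?gt_eqF.
- by move=> j; rewrite (semi_innerZr hp) (semi_innerC hp y) ye conjugate0 mulr0.
have wy : h w y = 0.
  rewrite (semi_inner_suml hp) big1// => i _.
  by rewrite (semi_innerC hp y) ye conjugate0 mulr0.
have -> : x = y + w by rewrite subrK.
rewrite (semi_innerDl hp) !(semi_innerZr hp) wy mulr0 addr0 (semi_inner_diag hp).
rewrite conjugate_of_real -rmorphM modulus_of_real expr2 mulKf ?gt_eqF//.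
by rewrite gtr0_norm// ltW.
Qed.

Let gram_neq0 m : (m <= n.+1)%N -> exists x z : 'I_m -> V,
  [/\ forall i, B (x i), forall j, p (z j) <= 1 & \det (gram x z) != 0].
Proof.
elim: m => [_|m IH mn].
  by exists (fun=> 0), (fun=> 0); rewrite det_mx00 oner_neq0; split=> // -[].
have [x [z [Bx z1 xz]]] := IH (ltnW mn).
have [x0 [z0 [Bx0 z01 xz0 dxz]]] := far_vector x mn.
exists (fun i => oapp x x0 (unlift ord0 i)), (fun i => oapp z z0 (unlift ord0 i)).
split; [by move=> i; case: unlift|by move=> i; case: unlift|].
(* As [z0] is orthogonal to the old vectors, [h x0 z0] is the only nonzero entry of the first
   column. *)
rewrite (expand_det_col _ ord0) big_ord_recl big1 ?addr0; last first.
  by move=> i _; rewrite !mxE unlift_none liftK/= xz0 mul0r.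
rewrite !mxE unlift_none/= mulf_neq0//.
  by rewrite -modulus_eq0 gt_eqF// (lt_le_trans d_gt0).
rewrite /cofactor expr0 mul1r; set G := row' _ _.
suff -> : G = gram x z by [].
by apply/matrixP => i j; rewrite !mxE !liftK.
Qed.

Let gram_det_bound (x z : 'I_n.+1 -> V) :
    (forall i, B (x i)) -> (forall j, p (z j) <= 1) ->
  modulus (\det (gram x z)) <= n.+1`!%:R * M ^+ n.+1.
Proof.
move=> Bx z1; apply: (le_trans (modulus_sum _ _ _)).
apply: (@le_trans _ _ (\sum_(t : 'S_n.+1) M ^+ n.+1)); last first.
  by rewrite sumr_const card_Sn mulr_natl.
apply: ler_sum => t _; rewrite modulusM modulus_prod.
have -> : modulus ((-1) ^+ t : K) = 1.
  by case: (odd_perm t); rewrite ?expr0 ?expr1 ?modulusN modulus1.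
rewrite mul1r -[n.+1 in leRHS]card_ord -prodr_const.
apply: ler_prod => i _; rewrite modulus_ge0 mxE.
by rewrite (le_trans (cauchy_schwarz_le _ (z1 _)))// BM.
Qed.

(** [B] need not be compact, so the supremum may not be attained; it is finite by [gram_det_bound]
    and positive by [gram_neq0], hence some determinant exceeds half of it. *)
Let gram_almost_max : exists x z : 'I_n.+1 -> V,
  [/\ forall i, B (x i), forall j, p (z j) <= 1, \det (gram x z) != 0 &
    forall x' z' : 'I_n.+1 -> V, (forall i, B (x' i)) -> (forall j, p (z' j) <= 1) ->
      modulus (\det (gram x' z')) <= 2 * modulus (\det (gram x z))].
Proof.
pose S := [set r | exists x z : 'I_n.+1 -> V, [/\ forall i, B (x i),
  forall j, p (z j) <= 1 & r = modulus (\det (gram x z))]].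
have [x0 [z0 [Bx0 z01 xz0]]] := gram_neq0 (leqnn _).
have hS : has_sup S.
  split; first by exists (modulus (\det (gram x0 z0))), x0, z0.
  by exists (n.+1`!%:R * M ^+ n.+1) => _ [x [z [Bx z1 ->]]]; exact: gram_det_bound.
have S0 : 0 < sup S.
  apply: (@lt_le_trans _ _ (modulus (\det (gram x0 z0)))).
    by rewrite lt_def modulus_ge0 modulus_eq0 xz0.
  by apply: ub_le_sup; [case: hS|exists x0, z0].
have [|_ [x [z [Bx z1 ->]]]] := sup_adherent (_ : 0 < sup S / 2) hS.
  by rewrite divr_gt0.
rewrite {1}[sup S]splitr addrK => Sxz.
exists x, z; split => //.
  by rewrite -modulus_eq0 gt_eqF// (lt_trans _ Sxz)// divr_gt0.
move=> x' z' Bx' z1'; apply: (@le_trans _ _ (sup S)).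
  by apply: ub_le_sup; [case: hS|exists x', z'].
by rewrite -ler_pdivrMl// mulrC ltW.
Qed.

(* For a system maximizing the determinant of the Gram matrix up to a factor 2, exchanging
   a single vector against the point of B farthest from the span of the others
   cannot enlarge the determinant; this bounds the cofactors. *)
Lemma kolmogorov_diam_basis : exists x : 'I_n.+1 -> V,
  (forall i, B (x i)) /\ forall (a : 'I_n.+1 -> K) i,
    modulus (a i) <= 2 * n.+1%:R / d * p (\sum_j a j *: x j).
Proof.
have [x [z [Bx z1 xz max]]] := gram_almost_max.
exists x; split => // a i.
set G := gram x z in xz max.
have G0 : 0 < modulus (\det G) by rewrite lt_def modulus_ge0 modulus_eq0 xz.
have cofactor_le j : modulus (cofactor G i j) <= 2 * modulus (\det G) / d.
  have [x0 [z0 [Bx0 z01 xz0 dxz]]] := far_vector (x \o lift i) (leqnn n).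
  pose x' k := if k == i then x0 else x k; pose z' k := if k == j then z0 else z k.
  (* In column [j] only the entry of row [i] survives, since [z0] is orthogonal to the [x k] with
     [k != i]. *)
  have detE : \det (gram x' z') = h x0 z0 * cofactor G i j.
    rewrite (expand_det_col _ j) (bigD1 i)//= big1 ?addr0; last first.
      move=> k; case: (unliftP i k) => [l -> _|->]; last by rewrite eqxx.
      rewrite !mxE /x' /z' eqxx [_ == i]eq_sym (negbTE (neq_lift _ _)).
      by have /= -> := xz0 l; rewrite mul0r.
    rewrite mxE /x' /z' !eqxx; congr (_ * (_ * \det _)).
    by apply/matrixP => k l; rewrite !mxE !(eq_sym (lift _ _)) !(negbTE (neq_lift _ _)).
  rewrite ler_pdivlMr// mulrC.
  apply: (@le_trans _ _ (modulus (\det (gram x' z')))).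
    by rewrite detE modulusM ler_wpM2r// modulus_ge0.
  apply: max => k; first by rewrite /x'; case: eqP.
  by rewrite /z'; case: eqP.
set y := \sum_j _.
(* The row of the [h y (z j)] is the row [a] times [G]; multiplying by the adjugate recovers [a]. *)
have cramer : a i * \det G = \sum_j h y (z j) * cofactor G i j.
  have /matrixP/(_ 0 i) : (\row_k a k) *m G *m \adj G = \det G *: \row_k a k.
    by rewrite -mulmxA mul_mx_adj mul_mx_scalar.
  rewrite !mxE mulrC => <-; apply: eq_bigr => j _; rewrite !mxE; congr (_ * _).
  by rewrite (semi_inner_suml hp); apply: eq_bigr => k _; rewrite !mxE.
rewrite -(ler_pM2r G0) -modulusM cramer; apply: (le_trans (modulus_sum _ _ _)).
apply: (@le_trans _ _ (\sum_(j < n.+1) p y * (2 * modulus (\det G) / d))).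
  apply: ler_sum => j _; rewrite modulusM ler_pM ?modulus_ge0//.
  exact: cauchy_schwarz_le.
rewrite sumr_const card_ord -[_ *+ n.+1]mulr_natl le_eqVlt; apply/orP; left; apply/eqP.
by field; rewrite gt_eqF.
Qed.

End AuerbachBasis.

(** * Power series spaces of finite type *)

Section PowerSeriesNorms.
Context {R : realType} {s : scalars}.
Local Notation K := (scalar_field R s).
Context {E : nat -> R}.
Local Notation PS := (power_series (s := s) E).
Implicit Types (x y : PS) (r : R).

Lemma ps_scaleE (c : K) x n : (c *: x) n = c * x n.
Proof. by []. Qed.

Lemma ps_coefs_sum (I : Type) (l : seq I) (F : I -> PS) n :
  (\sum_(i <- l) F i) n = \sum_(i <- l) F i n.
Proof. by elim: l => [|i l IH]; rewrite ?big_nil// !big_cons -IH. Qed.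

Lemma ps_norm_ge0 r x : 0 <= ps_norm r x.
Proof. exact: sqrtr_ge0. Qed.

Lemma ps_norm_sum_le r x N : r < 1 ->
  \sum_(0 <= k < N) modulus (x k) ^+ 2 * expR (2 * r * E k) <= ps_norm r x ^+ 2.
Proof.
move=> r1; have fx := ps_sqnorm_fin x r1.
rewrite sqr_sqrtr ?fine_ge0 ?ps_sqnorm_ge0// -lee_fin fineK// -sumEFin.
rewrite /ps_sqnorm; apply: (nneseries_lim_ge N) => k _ _.
by rewrite lee_fin mulr_ge0 ?sqr_ge0 ?expR_ge0.
Qed.

Lemma ps_sqnorm_le r (xi : nat -> K) (M : R) :
    (forall N, \sum_(0 <= k < N) modulus (xi k) ^+ 2 * expR (2 * r * E k) <= M) ->
  (ps_sqnorm E r xi <= M%:E)%E.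
Proof.
move=> xM; apply: lime_le.
  apply: is_cvg_nneseries => n _ _.
  by rewrite lee_fin mulr_ge0 ?sqr_ge0 ?expR_ge0.
by apply: nearW => N; rewrite sumEFin lee_fin.
Qed.

Lemma ps_norm_le r x (M : R) : 0 <= M ->
    (forall N, \sum_(0 <= k < N) modulus (x k) ^+ 2 * expR (2 * r * E k) <= M ^+ 2) ->
  ps_norm r x <= M.
Proof.
move=> M0 /ps_sqnorm_le xM; rewrite -(ler_pXn2r (_ : 0 < 2)%N) ?nnegrE ?ps_norm_ge0//.
rewrite sqr_sqrtr ?fine_ge0 ?ps_sqnorm_ge0// -lee_fin fineK//.
by rewrite ge0_fin_numE ?ps_sqnorm_ge0// (le_lt_trans xM)// ltry.
Qed.

Lemma ps_norm_coef r x k : r < 1 -> modulus (x k) * expR (r * E k) <= ps_norm r x.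
Proof.
move=> r1; rewrite -(ler_pXn2r (_ : 0 < 2)%N) ?nnegrE ?ps_norm_ge0//; last first.
  by rewrite mulr_ge0 ?modulus_ge0 ?expR_ge0.
apply: le_trans (ps_norm_sum_le x k.+1 r1); rewrite big_nat_recr//= exprMn.
rewrite -expRM_natl mulrA lerDr sumr_ge0// => i _.
by rewrite mulr_ge0 ?sqr_ge0 ?expR_ge0.
Qed.

Lemma ps_trunc_mem (f : nat -> K^o) n : (fun k => if (k < n)%N then f k else 0) \in ps_mem E.
Proof.
apply/asboolP => r _.
set g := fun k => _.
apply: le_lt_trans (ltry (\sum_(0 <= k < n) modulus (g k) ^+ 2 * expR (2 * r * E k))).
apply: ps_sqnorm_le => N.
have g0 k : 0 <= modulus (g k) ^+ 2 * expR (2 * r * E k).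
  by rewrite mulr_ge0 ?sqr_ge0 ?expR_ge0.
have [Nn|nN] := leqP N n.
  by rewrite [leRHS](big_cat_nat (n := N))//= lerDl sumr_ge0.
rewrite (big_cat_nat (n := n)) ?(ltnW nN)//= [X in _ + X]big_nat_cond [X in _ + X]big1 ?addr0//.
move=> k; rewrite andbT => /andP[nk _].
by rewrite /g ltnNge nk/= modulus0 expr0n mul0r.
Qed.

Definition ps_trunc (f : nat -> K^o) n : PS := PowerSeries (ps_trunc_mem f n).

Definition ps_basis n : PS := ps_trunc (fun k => (k == n)%:R) n.+1.

Lemma ps_truncE f n k : ps_trunc f n k = if (k < n)%N then f k else 0.
Proof. by []. Qed.

Lemma ps_basisE n k : ps_basis n k = (k == n)%:R.
Proof. by rewrite ps_truncE; have [->|] := eqVneq k n; rewrite ?leqnn ?if_same. Qed.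

Lemma ps_ext x y : (forall k, x k = y k) -> x = y.
Proof. by move=> xy; apply: val_inj; apply/funext. Qed.

Lemma ps_trunc_sum f n : ps_trunc f n = \sum_(i < n) (f i : K) *: ps_basis i.
Proof.
apply: ps_ext => k; rewrite ps_truncE ps_coefs_sum.
have [kn|nk] := ltnP k n.
  rewrite (bigD1 (Ordinal kn)) // ps_scaleE ps_basisE eqxx mulr1 big1; first by rewrite /= addr0.
  move=> i; move=> /andP[_ /eqP ik]; rewrite ps_scaleE ps_basisE.
  case: eqP => [ki|_]; last by rewrite mulr0.
  by case: ik; apply: val_inj.
rewrite big1// => i _; rewrite ps_scaleE ps_basisE.
by rewrite gtn_eqF ?mulr0// (leq_trans (ltn_ord i)).
Qed.

End PowerSeriesNorms.

Section FiniteType.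
Context {R : realType} {s : scalars}.
Local Notation K := (scalar_field R s).
Context {E : nat -> R} (E_ge0 : forall n, 0 <= E n).
Local Notation PS := (power_series (s := s) E).
Implicit Types (x y : PS) (r : R).

Lemma ps_norm_mono r r' x : r <= r' -> r' < 1 -> ps_norm r x <= ps_norm r' x.
Proof.
move=> rr' r'1; apply: ps_norm_le => [|N]; first exact: ps_norm_ge0.
apply: le_trans (ps_norm_sum_le x N r'1).
apply: ler_sum => k _; rewrite ler_wpM2l ?sqr_ge0// ler_expR.
by rewrite ler_wpM2r// ler_wpM2l.
Qed.

(** As [E] is nonnegative, the norms increase with [r], so finitely many of them are dominated by
    the one of largest index. *)
Lemma nbhs_psP x (A : set PS) : nbhs x A <->
  exists r e, [/\ r < 1, 0 < e & forall y, ps_norm r (y - x) < e -> A y].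
Proof.
split=> [[l [e [e0 HA]]]|[r [e [r1 e0 HA]]]].
  (* Starting the maximum at 0 keeps it below 1 for the empty list too. *)
  pose r := \big[Num.max/0]_(i <- l) val i.
  have r1 : r < 1.
    by rewrite /r; elim/big_rec: _ => // i z _ z1; rewrite gt_max z1 (valP i).
  exists r, e; split => // y ye; apply: HA => i il.
  apply: (le_lt_trans _ ye); apply: ps_norm_mono => //.
  by rewrite /r; apply: le_bigmax_seq.
exists [:: exist _ r r1], e; split => // y Hy; apply: HA.
exact: (Hy (exist _ r r1) (mem_head _ _)).
Qed.

End FiniteType.

(** * Seminorms controlled by neighbourhoods of zero *)

Section SeminormBounds.
Context {R : realType} {s : scalars}.
Local Notation K := (scalar_field R s).

Lemma seminorm_le_of_ball (V : lmodType K) (p q : V -> R) (e : R) :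
    seminorm p -> seminorm q -> 0 < e -> (forall x, p x < e -> q x < 1) ->
  forall x, q x <= e^-1 * p x.
Proof.
move=> hp hq e0 pq x; apply/ler_addgt0Pr => d d0.
have px0 := seminorm_ge0 hp x.
(* The summand [e * d] keeps the denominator positive when [p x = 0] and puts [of_real c *: x]
   strictly inside the ball; it contributes only the error [d] to the final bound. *)
pose c := e / (p x + e * d).
have pd0 : 0 < p x + e * d by rewrite ltr_wpDl// mulr_gt0.
have c0 : 0 < c by rewrite divr_gt0.
have cN z r : seminorm r -> r (of_real c *: z : V) = c * r z.
  by move=> hr; rewrite (seminormZ hr) modulus_of_real gtr0_norm.
have /pq : p (of_real c *: x) < e.
  rewrite cN// /c mulrAC ltr_pdivrMr// ltr_pM2l// ltrDl mulr_gt0//.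
rewrite cN// mulrC -ltr_pdivlMr// mul1r => /ltW/le_trans; apply.
by rewrite /c invf_div mulrDl mulrAC divff ?gt_eqF// mul1r mulrC.
Qed.

Lemma continuous_of_nbhs0 (X : tvsType K) (p : X -> R) : seminorm p ->
  (forall e, 0 < e -> nbhs 0 [set x | p x < e]) -> continuous_seminorm p.
Proof.
move=> hp p0; split => // x; apply/cvgrPdist_lt => e /p0/(nbhsT x).
apply: filterS => _ [y /= ye <-].
have := seminormD hp x y; have := seminormB (x + y) y hp; rewrite addrK ltr_norml.
by move: ye => /=; move: (p y) (p x) (p (x + y)) => a b c; lra.
Qed.

Lemma continuous_seminorm_ball (X : tvsType K) (q : X -> R) (e : R) :
  continuous_seminorm q -> 0 < e -> nbhs (0 : X) [set x | q x < e].
Proof.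
move=> [hq cq] e0; have : q x @[x --> (0 : X)] --> q 0 := cq 0.
rewrite (seminorm0 hq) => /cvgr0Pnorm_lt/(_ _ e0).
by apply: filterS => x; rewrite /= ger0_norm// (seminorm_ge0 hq).
Qed.

End SeminormBounds.

Lemma cvgr0_sum {R : realType} (u : nat -> nat -> R) n :
    (forall k, u k N @[N --> \oo] --> (0 : R)) ->
  \sum_(0 <= k < n) u k N @[N --> \oo] --> (0 : R).
Proof.
move=> u0; elim: n => [|n IH].
  by under eq_fun do rewrite big_geq//; exact: cvg_cst.
have -> : (fun N => \sum_(0 <= k < n.+1) u k N) =
    (fun N => \sum_(0 <= k < n) u k N + u n N).
  by apply/funext => N; rewrite big_nat_recr.
have := cvgD IH (u0 n); rewrite addr0; exact.
Qed.

(** * Summability of exponentials from nuclearity *)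

Section NuclearPowerSeries.
Context {R : realType} {s : scalars}.
Local Notation K := (scalar_field R s).
Context {E : nat -> R} (E_ge0 : forall n, 0 <= E n).
Local Notation PS := (power_series (s := s) E).

Lemma ps_norm_continuous r : r < 1 -> continuous_seminorm (@ps_norm R s E r).
Proof.
move=> r1; apply: continuous_of_nbhs0; first exact: ps_norm_seminorm.
move=> e e0; apply/(nbhs_psP E_ge0); exists r, e; split => // y /=.
by rewrite subr0.
Qed.

Lemma continuous_seminorm_psP (q : PS -> R) : continuous_seminorm q ->
  exists r C, [/\ r < 1, 0 < C & forall x, q x <= C * ps_norm r x].
Proof.
move=> cq; have [hq _] := cq.
have /(nbhs_psP E_ge0)[r [e [r1 e0 H]]] := continuous_seminorm_ball cq ltr01.
exists r, e^-1; split; rewrite ?invr_gt0//.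
apply: seminorm_le_of_ball => //; first exact: ps_norm_seminorm.
by move=> x xe; apply: H; rewrite subr0.
Qed.

(* The trace of the diagonal operator e_k |-> e^{-(r' - r) E_k} e_k, truncated to k < M,
   is computed from a nuclear representation of the canonical map between the local
   Banach spaces of |.|_{r'} and |.|_r. *)
Lemma nuclear_ps_summable (d : R) : nuclear PS -> 0 < d ->
  exists C : R, forall M, \sum_(0 <= k < M) expR (- (d * E k)) <= C.
Proof.
move=> nPS d0; pose r := 1 - d.
have r1 : r < 1 by rewrite /r ltrBlDr ltrDl.
have [q cq [_ [c [f [y [cc fq y1 repr]]]]]] := nPS _ (ps_norm_continuous r1).
have [r0 [C [r01 C0 qC]]] := continuous_seminorm_psP cq.
pose r' := Num.max r r0.
have r'1 : r' < 1 by rewrite gt_max r1.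
have rr' : r <= r' by rewrite le_max lexx.
have {}qC x : q x <= C * ps_norm r' x.
  apply: (le_trans (qC x)); rewrite ler_pM2l//; apply: ps_norm_mono => //.
  by rewrite le_max lexx orbT.
(* Since [r' < 1 = r + d], these weights dominate [expR (- (d * E k))]; they convert the norm of
   index [r'] into that of index [r]. *)
pose w k := expR (- ((r' - r) * E k)).
pose D := limn (series (fun n => modulus (c n))).
have cD N : \sum_(0 <= n < N) modulus (c n) <= D.
  apply: (nondecreasing_cvgn_le _ cc); apply/nondecreasing_seqP => n.
  by rewrite /series/= big_nat_recr//= lerDl modulus_ge0.
exists (C * D) => M; apply: (@le_trans _ _ (\sum_(0 <= k < M) w k)).
  apply: ler_sum => k _; rewrite ler_expR lerN2 ler_wpM2r//.
  by rewrite /r; move: r'1; lra.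
(* The sum is [f n] applied to [y n] multiplied by [w] and cut at [M]. The weights bring the norm of
   index [r'] of this vector below the norm of index [r] of [y n], which is at most 1. *)
have diag n : modulus (\sum_(0 <= k < M) (of_real (w k) : K) * (f n (ps_basis k) * y n k)) <= C.
  pose x : PS := ps_trunc (fun k => (of_real (w k) : K) * y n k) M.
  have -> : \sum_(0 <= k < M) (of_real (w k) : K) * (f n (ps_basis k) * y n k) = f n x.
    rewrite /x ps_trunc_sum linear_sum/= big_mkord; apply: eq_bigr => k _.
    by rewrite linearZ/= mulrCA mulrC -mulrA.
  apply: (le_trans (fq n x)); apply: (le_trans (qC x)).
  rewrite ler_piMr ?(ltW C0)//; apply: (le_trans _ (y1 n)).
  apply: ps_norm_le => [|N]; first exact: ps_norm_ge0.
  apply: le_trans (ps_norm_sum_le (y n) N r1); apply: ler_sum => k _.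
  rewrite ps_truncE; case: ifP => _; last first.
    by rewrite modulus0 expr0n mul0r mulr_ge0 ?sqr_ge0 ?expR_ge0.
  rewrite modulusM modulus_of_real ger0_norm ?expR_ge0// exprMn mulrAC.
  rewrite [leLHS]mulrC ler_wpM2l ?sqr_ge0// -expRM_natl -expRD ler_expR.
  by rewrite le_eqVlt; apply/orP; left; apply/eqP; ring.
(* This bounds the error, weighted by [w k], of the first [N] terms of the representation in the
   diagonal entry [k]. *)
pose u k N := w k * expR (- (r * E k)) *
  ps_norm r (ps_basis k - \sum_(0 <= n < N) (c n * f n (ps_basis k)) *: y n).
have u0 k : u k N @[N --> \oo] --> (0 : R).
  have := cvgM (cvg_cst (w k * expR (- (r * E k)))) (repr (ps_basis k)).
  rewrite mulr0; exact.
have main N : \sum_(0 <= k < M) w k <= \sum_(0 <= k < M) u k N + C * D.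
  pose z k : K := 1 - \sum_(0 <= n < N) c n * f n (ps_basis k) * y n k.
  have zE k : z k = (ps_basis k - \sum_(0 <= n < N) (c n * f n (ps_basis k)) *: y n : PS) k.
    transitivity ((ps_basis k : PS) k -
      (\sum_(0 <= n < N) (c n * f n (ps_basis k)) *: y n : PS) k); last by [].
    by rewrite ps_basisE eqxx ps_coefs_sum.
  have zu k : w k * modulus (z k) <= u k N.
    rewrite /u -mulrA ler_wpM2l ?expR_ge0// expRN ler_pdivlMl ?expR_gt0// mulrC zE.
    exact: ps_norm_coef.
  (* Each diagonal entry 1 splits into the error [z k] and the rank-one contributions, for which the
     sums over [k] and [n] are exchanged. *)
  have wE : (of_real (\sum_(0 <= k < M) w k) : K) = \sum_(0 <= k < M) of_real (w k) * z k +
      \sum_(0 <= n < N) c n * \sum_(0 <= k < M) (of_real (w k) : K) * (f n (ps_basis k) * y n k).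
    under [X in _ + X]eq_bigr do rewrite mulr_sumr.
    rewrite exchange_big/= -big_split/= rmorph_sum/=; apply: eq_bigr => k _.
    rewrite /z mulrBr mulr1 mulr_sumr -[LHS](subrK (\sum_(0 <= n < N)
      of_real (w k) * (c n * f n (ps_basis k) * y n k))).
    by congr (_ + _); apply: eq_bigr => n _; rewrite -!mulrA mulrCA.
  have w0 : 0 <= \sum_(0 <= k < M) w k by rewrite sumr_ge0// => k _; exact: expR_ge0.
  rewrite -(ger0_norm w0) -(@modulus_of_real R s) wE.
  apply: (le_trans (modulusD _ _)); apply: lerD.
    apply: (le_trans (modulus_sum _ _ _)); apply: ler_sum => k _.
    by rewrite modulusM modulus_of_real ger0_norm ?expR_ge0.
  apply: (le_trans (modulus_sum _ _ _)).
  apply: (@le_trans _ _ (\sum_(0 <= n < N) C * modulus (c n))).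
    apply: ler_sum => n _; rewrite modulusM mulrC ler_wpM2r ?modulus_ge0//.
  by rewrite -mulr_sumr ler_pM2l.
have lim : \sum_(0 <= k < M) u k N + C * D @[N --> \oo] --> C * D.
  have := cvgD (cvgr0_sum M u0) (cvg_cst (C * D)); rewrite add0r; exact.
rewrite -(cvg_lim _ lim)//; apply: limr_ge; first by apply/cvg_ex; eexists; exact: lim.
by apply: nearW => N; exact: main.
Qed.

End NuclearPowerSeries.

(** * Exponential decay and approximate diametral dimensions *)

Definition exp_decay {R : realType} {s : scalars} (E : nat -> R) :
    set (nat -> scalar_field R s) :=
  [set t | exists2 d : R, 0 < d &
    \forall n \near \oo, modulus (t n) <= expR (- (d * E n))].

Section Exponents.
Context {R : realType} {s : scalars}.
Local Notation K := (scalar_field R s).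
Context {E : nat -> R} (E_ge0 : forall n, 0 <= E n)
  (E_mono : {homo E : m n / (m <= n)%N >-> m <= n})
  (E_summable : forall d, 0 < d ->
    exists C : R, forall M, \sum_(0 <= k < M) expR (- (d * E k)) <= C).

(** By monotonicity each of the first [n.+1] terms of the series is at least [expR (- (d * E n))].
    This is what absorbs the polynomial factors in the diameter estimates. *)
Lemma index_le_exp d : 0 < d -> exists2 C, 0 < C & forall n, n.+1%:R <= C * expR (d * E n).
Proof.
move=> d0; have [C HC] := E_summable d0.
have C0 : 0 < C by apply: lt_le_trans (HC 1); rewrite big_nat1 expR_gt0.
exists C => // n; rewrite -ler_pdivrMr ?expR_gt0// -expRN.
apply: (le_trans _ (HC n.+1)); rewrite big_mkord.
apply: (@le_trans _ _ (\sum_(k < n.+1) expR (- (d * E n)))).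
  by rewrite sumr_const card_ord mulr_natl.
apply: ler_sum => k _; rewrite ler_expR lerN2 ler_pM2l// E_mono//.
by rewrite -ltnS.
Qed.

Lemma exponent_dvg M : \forall n \near \oo, M <= E n.
Proof.
have [C C0 HC] := index_le_exp ltr01.
near=> n; rewrite leNgt; apply/negP => EM.
have : n.+1%:R < C * expR M.
  by rewrite (le_lt_trans (HC n))// ltr_pM2l// ltr_expR mul1r.
apply/negP; rewrite -leNgt; apply: (@le_trans _ _ n%:R); last by rewrite ler_nat.
by near: n; exact: nbhs_infty_ger.
Unshelve. all: by end_near. Qed.

Lemma exponent_exp_dvg (C d : R) : 0 < d -> \forall n \near \oo, C <= expR (d * E n).
Proof.
move=> d0; near=> n; apply: (@le_trans _ _ (1 + d * E n)); last exact: expR_ge1Dx.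
have : C / d <= E n by near: n; exact: exponent_dvg.
by rewrite ler_pdivrMr// mulrC; lra.
Unshelve. all: by end_near. Qed.

(** A sequence in the diametral dimension is eventually below the diameters; half of the rate [d]
    absorbs the constant [C], because [E] tends to infinity. *)
Lemma approx_diametral_dim_sub (X : tvsType K) :
    (forall U B, nbhs (0 : X) U -> tvs_bounded B -> exists C d, 0 < d /\
      forall n, (kolmogorov_diam n B U <= (C * expR (- (d * E n)))%:E)%E) ->
  approx_diametral_dim X `<=` exp_decay E.
Proof.
move=> H t [U [B [U0 Bb kd0 tkd]]]; have [C [d [d0 kdC]]] := H U B U0 Bb.
exists (d / 2); first by rewrite divr_gt0.
have /cvgr0Pnorm_lt/(_ 1 ltr01) tk1 := tkd.
near=> n.
have : `|t n / of_real (fine (kolmogorov_diam n B U))| < 1 by near: n.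
have kdn := kdC n; have kd0n := kd0 n; move: kdn kd0n.
case: (kolmogorov_diam n B U) => [k| |]//; rewrite lee_fin lte_fin /= => kC k0.
rewrite normr_modulus -(rmorph1 of_real) ltr_of_real modulusM modulusV modulus_of_real.
rewrite gtr0_norm// ltr_pdivrMr// mul1r => /ltW/le_trans; apply.
apply: (le_trans kC).
have -> : - (d * E n) = - (d / 2 * E n) - d / 2 * E n by field.
rewrite expRD mulrCA ler_piMr ?expR_ge0// expRN ler_pdivrMr ?expR_gt0// mul1r.
by near: n; apply: exponent_exp_dvg; rewrite divr_gt0.
Unshelve. all: by end_near. Qed.

(** Against a sequence of rate [d], diameters of rate [d / 2] leave a factor
    [expR (- (d / 2 * E n))] in the quotient, which tends to 0. *)
Lemma approx_diametral_dim_sup (X : tvsType K) :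
    (forall d, 0 < d -> exists U B c, [/\ nbhs (0 : X) U, tvs_bounded B, 0 < c &
      forall n, ((c * expR (- (d * E n)))%:E <= kolmogorov_diam n B U)%E]) ->
  exp_decay E `<=` approx_diametral_dim X.
Proof.
move=> H t [d d0 td]; have d2 : 0 < d / 2 by rewrite divr_gt0.
have [U [B [c [U0 Bb c0 kdc]]]] := H _ d2.
exists U, B; split => // [n|].
  by apply: lt_le_trans (kdc n); rewrite lte_fin mulr_gt0 ?expR_gt0.
apply/cvgr0Pnorm_lt => e e0; near=> n.
have e'0 : 0 < modulus e.
  by rewrite -(@ltr_of_real R s) rmorph0 -normr_modulus normr_gt0 gt_eqF.
have -> : e = of_real (modulus e) by rewrite -normr_modulus gtr0_norm.
rewrite normr_modulus ltr_of_real modulusM modulusV modulus_of_real.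
(* A diameter [+oo] becomes 0 under [fine], and division by 0 gives 0, so that case is trivial. *)
have := kdc n; case: (kolmogorov_diam n B U) => [k| |]//=; rewrite ?normr0 ?invr0 ?mulr0//.
rewrite lee_fin => ck.
have k0 : 0 < k by apply: lt_le_trans ck; rewrite mulr_gt0 ?expR_gt0.
rewrite gtr0_norm// ltr_pdivrMr//.
apply: (@lt_le_trans _ _ (modulus e * (c * expR (- (d / 2 * E n))))); last first.
  by rewrite ler_pM2l.
have tn : modulus (t n) <= expR (- (d * E n)) by near: n.
apply: (le_lt_trans tn).
have -> : - (d * E n) = - (d / 2 * E n) - d / 2 * E n by field.
rewrite expRD [in ltRHS]mulrA ltr_pM2r ?expR_gt0// expRN.
rewrite invf_plt ?posrE ?expR_gt0 ?mulr_gt0//.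
apply: (@lt_le_trans _ _ ((modulus e * c)^-1 + 1)); first by rewrite ltrDl.
by near: n; exact: exponent_exp_dvg.
Unshelve. all: by end_near. Qed.

Local Notation PS := (power_series (s := s) E).

(** Truncation at [n] approximates [B]: on the tail, passing from the norm of index [r'] to that of
    index [r] gains [expR (- ((r' - r) * E n))], where [r'] is midway between [r] and 1. *)
Lemma ps_kolmogorov_diam_le (U B : set PS) : nbhs (0 : PS) U -> tvs_bounded B ->
  exists C d, 0 < d /\
    forall n, (kolmogorov_diam n B U <= (C * expR (- (d * E n)))%:E)%E.
Proof.
move=> /(nbhs_psP E_ge0)[r [e [r1 e0 rU]]] Bb.
pose r' := (1 + r) / 2.
have [r'1 rr'] : r' < 1 /\ r < r' by rewrite /r'; split; lra.
have [lam lam0 BL] : exists2 lam : R, 0 < lam & forall x, B x -> ps_norm r' x < lam.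
  have [|lam lam0 BL] := Bb [set x | ps_norm r' x < 1].
    by apply/(nbhs_psP E_ge0); exists r', 1; split => // x /=; rewrite subr0.
  exists lam => // x /BL[u /= u1 <-].
  rewrite (seminormZ (ps_norm_seminorm E r'1)) modulus_of_real gtr0_norm//.
  by rewrite -[ltRHS]mulr1 ltr_pM2l.
exists (lam / e), (r' - r); split; first by rewrite subr_gt0.
move=> n; set mu := _ * expR _.
have mu0 : 0 < mu by rewrite !mulr_gt0 ?invr_gt0 ?expR_gt0.
pose L := [set x : PS | exists a : 'I_n -> K, x = \sum_i a i *: ps_basis i].
apply: (@kolmogorov_diam_ub _ _ _ _ _ _ L) => //.
- exact: linear_subspace_span.
- by exists (fun i : 'I_n => ps_basis i).
move=> x /BL xlam; exists (of_real mu^-1 *: (x - ps_trunc x n)); last first.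
  exists (ps_trunc x n); first by exists (fun i : 'I_n => x i : K); exact: ps_trunc_sum.
  by rewrite scalerA -rmorphM divff ?gt_eqF// rmorph1 scale1r subrK.
apply: rU; rewrite subr0 (seminormZ (ps_norm_seminorm E r1)) modulus_of_real.
rewrite gtr0_norm ?invr_gt0// ltr_pdivrMl//.
have -> : mu * e = expR (- ((r' - r) * E n)) * lam by rewrite /mu; field; rewrite gt_eqF.
apply: (@le_lt_trans _ _ (expR (- ((r' - r) * E n)) * ps_norm r' x)); last first.
  by rewrite ltr_pM2l ?expR_gt0.
apply: ps_norm_le => [|N]; first by rewrite mulr_ge0 ?expR_ge0 ?ps_norm_ge0.
rewrite exprMn; apply: (@le_trans _ _ (expR (- ((r' - r) * E n)) ^+ 2 *
    \sum_(0 <= k < N) modulus (x k) ^+ 2 * expR (2 * r' * E k))); last first.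
  by rewrite ler_wpM2l ?sqr_ge0// ps_norm_sum_le.
rewrite mulr_sumr; apply: ler_sum => k _.
have -> : (x - ps_trunc x n) k = x k - (if (k < n)%N then x k else 0) by [].
case: ltnP => kn.
  by rewrite subrr modulus0 expr0n mul0r mulr_ge0 ?sqr_ge0// mulr_ge0 ?sqr_ge0 ?expR_ge0.
rewrite subr0 mulrCA ler_wpM2l ?sqr_ge0// -expRM_natl -expRD ler_expR.
have : 0 <= (r' - r) * (E k - E n) by rewrite mulr_ge0 ?subr_ge0 ?E_mono// ltW.
by lra.
Qed.

(** The unit ball of the norm of index 1, written with partial sums: this norm may be infinite on
    the space, and [ps_norm 1] would then read 0. *)
Definition ps_ball : set PS := [set x | forall N,
  \sum_(0 <= k < N) modulus (x k) ^+ 2 * expR (2 * E k) <= 1].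

Lemma ps_ball_bounded : tvs_bounded ps_ball.
Proof.
move=> U /(nbhs_psP E_ge0)[r' [e [r'1 e0 rU]]].
exists (2 / e); first by rewrite divr_gt0.
move=> x Bx; exists (of_real (e / 2) *: x); last first.
  rewrite scalerA -rmorphM -[RHS]scale1r -(rmorph1 of_real).
  by congr (of_real _ *: _); field; rewrite gt_eqF.
apply: rU; rewrite subr0 (seminormZ (ps_norm_seminorm E r'1)) modulus_of_real.
rewrite gtr0_norm ?divr_gt0// (@le_lt_trans _ _ (e / 2 * 1))//; last by lra.
rewrite ler_pM2l ?divr_gt0//; apply: ps_norm_le => // N; rewrite expr1n.
apply: le_trans (Bx N); apply: ler_sum => k _.
by rewrite ler_wpM2l ?sqr_ge0// ler_expR ler_wpM2r//; lra.
Qed.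

Lemma ps_span_coef n (a : 'I_n.+1 -> K) (k : 'I_n.+1) :
  (\sum_i a i *: ps_basis i : PS) k = a k.
Proof.
have -> : \sum_i a i *: ps_basis i = ps_trunc (fun k => oapp a 0 (insub k)) n.+1 :> PS.
  by rewrite ps_trunc_sum; apply: eq_bigr => i _; rewrite valK.
by rewrite ps_truncE ltn_ord valK.
Qed.

(** On the span of the first [n.+1] unit vectors the norm of index 1 is at most
    [expR ((1 - r) * E n)] times the norm of index [r]. *)
Lemma ps_span_ball n (a : 'I_n.+1 -> K) r (x := \sum_i a i *: ps_basis i : PS) : r <= 1 ->
    \sum_(0 <= k < n.+1) modulus (x k) ^+ 2 * expR (2 * r * E k) <=
      expR (- ((1 - r) * E n)) ^+ 2 ->
  ps_ball x.
Proof.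
move=> r1 Na M.
have xk k : (n < k)%N -> x k = 0.
  move=> nk; rewrite /x ps_coefs_sum big1// => i _.
  by rewrite ps_scaleE ps_basisE gtn_eqF ?mulr0// (leq_trans (ltn_ord i)).
have S0 k : 0 <= modulus (x k) ^+ 2 * expR (2 * E k) by rewrite mulr_ge0 ?sqr_ge0 ?expR_ge0.
apply: (@le_trans _ _ (\sum_(0 <= k < n.+1) modulus (x k) ^+ 2 * expR (2 * E k))).
  have [Mn|nM] := leqP M n.+1.
    by rewrite [leRHS](big_cat_nat (n := M))//= lerDl sumr_ge0.
  rewrite (big_cat_nat (n := n.+1)) ?(ltnW nM)//= [X in _ + X]big_nat_cond.
  rewrite [X in _ + X]big1 ?addr0// => k; rewrite andbT => /andP[nk _].
  by rewrite xk// modulus0 expr0n mul0r.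
apply: (@le_trans _ _ (expR (2 * ((1 - r) * E n)) *
    \sum_(0 <= k < n.+1) modulus (x k) ^+ 2 * expR (2 * r * E k))); last first.
  rewrite (le_trans (ler_wpM2l (expR_ge0 _) Na))// -expRM_natl -expRD.
  by rewrite -[leRHS]expR0 ler_expR; lra.
rewrite mulr_sumr !big_mkord; apply: ler_sum => k _; rewrite mulrCA ler_wpM2l ?sqr_ge0//.
rewrite -expRD ler_expR.
have : 0 <= (1 - r) * (E n - E k).
  by rewrite mulr_ge0 ?subr_ge0// E_mono// -ltnS.
by lra.
Qed.

Lemma ps_kolmogorov_diam_ge d : 0 < d -> exists (U B : set PS) c,
  [/\ nbhs (0 : PS) U, tvs_bounded B, 0 < c &
      forall n, ((c * expR (- (d * E n)))%:E <= kolmogorov_diam n B U)%E].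
Proof.
move=> d0; pose r := 1 - d; have r1 : r < 1 by rewrite /r; lra.
exists (closed_unit_ball (ps_norm r)), ps_ball, 1; split => //.
- apply/(nbhs_psP E_ge0); exists r, 1; split => // x; rewrite subr0.
  by rewrite /closed_unit_ball/= => /ltW.
- exact: ps_ball_bounded.
move=> n; rewrite mul1r.
pose wt k := expR (2 * r * E k).
(* The inner product of index [r] cut to [n.+1] coordinates is a finite sum, stays below the square
   of [ps_norm r], and is definite on the span of the corresponding unit vectors. *)
pose h (x y : PS) : K := \sum_(k < n.+1) x k * conjugate (y k) * of_real (wt k).
pose N (x : PS) := \sum_(k < n.+1) modulus (x k) ^+ 2 * wt k.
have wt0 k : 0 < wt k by exact: expR_gt0.
have hN : semi_inner h N.
  split=> [a x y z|x y|x|x].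
  - rewrite /h mulr_sumr -big_split; apply: eq_bigr => k _.
    by rewrite [LHS](_ : _ = (a * x k + y k) * conjugate (z k) * of_real (wt k))//=; ring.
  - rewrite /h; elim/big_ind2: _ => [|a b c1 c2 -> ->|k _]; rewrite ?conjugate0 ?conjugateD//.
    by rewrite !conjugateM conjugate_of_real conjugateK [in RHS](mulrC (conjugate _)).
  - rewrite /h rmorph_sum; apply: eq_bigr => k _.
    by rewrite mul_conjugate -rmorphM.
  - by rewrite sumr_ge0// => k _; rewrite mulr_ge0 ?sqr_ge0 ?(ltW (wt0 _)).
apply: (kolmogorov_diam_ge hN (x := fun i : 'I_n.+1 => ps_basis i)).
- exact: ps_norm_seminorm.
- by move=> y; have := ps_norm_sum_le y n.+1 r1; rewrite big_mkord.
- exact: expR_gt0.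
- move=> a /eqP; rewrite psumr_eq0; last first.
    by move=> k _; rewrite mulr_ge0 ?sqr_ge0 ?(ltW (wt0 _)).
  move=> /allP ak i; have := ak i (mem_index_enum _); rewrite ps_span_coef mulf_eq0.
  by rewrite (gt_eqF (wt0 _)) orbF sqrf_eq0 modulus_eq0 => /eqP.
move=> a Na; apply: (ps_span_ball (r := r)); first exact: ltW.
by rewrite big_mkord /r subKr.
Qed.

End Exponents.

(** * Graded spaces with DN *)

Section HilbertianNorms.
Context {R : realType} {s : scalars}.
Local Notation K := (scalar_field R s).
Context {V : lmodType K}.

Lemma hilbertian_normP (p : V -> R) : hilbertian_norm p ->
  exists h : V -> V -> K, semi_inner h (fun x => p x ^+ 2).
Proof.
move=> [_ _ [h [h1 h2 h3]]]; exists h; split => // x; exact: sqr_ge0.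
Qed.

Lemma kolmogorov_diam_ge_span n (p : V -> R) (x : 'I_n.+1 -> V) (B : set V) (d : R) :
    hilbertian_norm p -> 0 < d ->
    (forall a, \sum_i a i *: x i = 0 -> forall i, a i = 0) ->
    (forall a, p (\sum_i a i *: x i) <= d -> B (\sum_i a i *: x i)) ->
  (d%:E <= kolmogorov_diam n B (closed_unit_ball p))%E.
Proof.
move=> hp d0 xfree xB; have [ps p0 _] := hp; have [h hN] := hilbertian_normP hp.
apply: (kolmogorov_diam_ge hN ps _ d0) => // a.
  by move=> /eqP; rewrite sqrf_eq0 => /eqP/p0/xfree.
rewrite ler_pXn2r ?nnegrE ?(seminorm_ge0 ps) ?(ltW d0)//; exact: xB.
Qed.

(** The coefficient bound of [kolmogorov_diam_basis] gives independence; as every [x i] lies in the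
    unit ball of [q], the triangle inequality adds a second factor [n.+1]. *)
Lemma kolmogorov_diam_span n (p q : V -> R) (d : R) :
    hilbertian_norm p -> seminorm q -> (forall x, p x <= q x) -> 0 < d ->
    (d%:E < kolmogorov_diam n (closed_unit_ball q) (closed_unit_ball p))%E ->
  exists x : 'I_n.+1 -> V, (forall a, \sum_i a i *: x i = 0 -> forall i, a i = 0) /\
    forall a, q (\sum_i a i *: x i) <= 2 * n.+1%:R ^+ 2 / d * p (\sum_i a i *: x i).
Proof.
move=> hp qs pq d0 dK; have [ps p0 _] := hp; have [h hN] := hilbertian_normP hp.
have [x Bx|x [xB xa]] := kolmogorov_diam_basis hN ps p0 (M := 1) d0 _ dK.
  exact: le_trans (pq x) Bx.
exists x; split=> a.
  move=> a0 i; apply/eqP; rewrite -modulus_eq0 eq_le modulus_ge0 andbT.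
  by rewrite (le_trans (xa a i))// a0 (seminorm0 ps) mulr0.
have qsum (I : Type) (l : seq I) (F : I -> V) : q (\sum_(i <- l) F i) <= \sum_(i <- l) q (F i).
  elim/big_rec2: _ => [|i u v _ uv]; first by rewrite (seminorm0 qs).
  by rewrite (le_trans (seminormD qs _ _))// lerD2l.
set y := \sum_i a i *: x i.
have /le_trans : q y <= \sum_i q (a i *: x i) by exact: qsum.
apply; apply: (@le_trans _ _ (\sum_(i < n.+1) 2 * n.+1%:R / d * p y)).
  apply: ler_sum => i _; rewrite (seminormZ qs); apply: le_trans (xa a i).
  by rewrite ler_piMr ?modulus_ge0//; exact: xB.
rewrite sumr_const card_ord -[_ *+ n.+1]mulr_natl le_eqVlt; apply/orP; left; apply/eqP.
by field; rewrite gt_eqF.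
Qed.

Lemma kolmogorov_diam_le1 n (p q : V -> R) : (forall x, p x <= q x) ->
  (kolmogorov_diam n (closed_unit_ball q) (closed_unit_ball p) <= 1)%E.
Proof.
move=> pq; apply: (@kolmogorov_diam_ub _ _ _ _ _ _ [set 0]) => //.
- by split=> // a x y -> ->; rewrite scaler0 addr0.
- by exists (fun=> 0) => x ->; exists (fun=> 0); rewrite big1// => i _; rewrite scaler0.
move=> x qx; exists x; first exact: le_trans (pq x) qx.
by exists 0; rewrite ?rmorph1 ?scale1r ?addr0.
Qed.

End HilbertianNorms.

(** * The topology defined by a grading *)

Section Grading.
Context {R : realType} {s : scalars}.
Local Notation K := (scalar_field R s).
Context {X : tvsType K} {nrm : nat -> X -> R}.
Hypothesis nrm_grading : hilbertian_grading nrm.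
Let U k := closed_unit_ball (nrm k).

Lemma grading_hilbertian k : hilbertian_norm (nrm k).
Proof. by case: nrm_grading. Qed.

Lemma grading_seminorm k : seminorm (nrm k).
Proof. by case: (grading_hilbertian k). Qed.

Lemma grading_mono j k x : (j <= k)%N -> nrm j x <= nrm k x.
Proof.
case: nrm_grading => _ + _ => nS; elim: k => [|k IH]; first by rewrite leqn0 => /eqP->.
by rewrite leq_eqVlt ltnS => /predU1P[->//|/IH/le_trans]; apply.
Qed.

Lemma grading_nbhs x (A : set X) : nbhs x A <->
  exists k e, 0 < e /\ forall y, nrm k (y - x) < e -> A y.
Proof.
have [_ _ n0] := nrm_grading; split=> [xA|[k [e [e0 H]]]].
  have := nbhsB (- x) xA; rewrite addNr => /n0[k [e [e0 H]]].
  exists k, e; split => // y /H[z Az /eqP].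
  by rewrite [- x + z]addrC subr_eq subrK => /eqP <-.
have : nbhs (0 : X) [set y | nrm k y < e] by apply/n0; exists k, e; split => // ?.
by move=> /(nbhsT x); apply: filterS => _ [y ye <-]; apply: H; rewrite addrAC subrr add0r.
Qed.

Lemma grading_continuous k : continuous_seminorm (nrm k).
Proof.
apply: continuous_of_nbhs0; first exact: grading_seminorm.
by move=> e e0; apply/grading_nbhs; exists k, e; split => // y; rewrite subr0.
Qed.

Lemma continuous_seminorm_gradingP (q : X -> R) : continuous_seminorm q ->
  exists k C, 0 < C /\ forall x, q x <= C * nrm k x.
Proof.
move=> cq; have [hq _] := cq.
have /grading_nbhs[k [e [e0 H]]] := continuous_seminorm_ball cq ltr01.
exists k, e^-1; split; rewrite ?invr_gt0//.
apply: seminorm_le_of_ball => //; first exact: grading_seminorm.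
by move=> x xe; apply: H; rewrite subr0.
Qed.

(** [A] contains a multiple of [U k], which fixes [k]; boundedness puts [B] into a multiple of every
    [U q], so [q] stays free. *)
Lemma kolmogorov_diam_bounded (B A : set X) : tvs_bounded B -> nbhs (0 : X) A ->
  exists k, forall q, exists2 c, 0 < c &
    forall n, (kolmogorov_diam n B A <= c%:E * kolmogorov_diam n (U q) (U k))%E.
Proof.
move=> Bb /grading_nbhs[k [e [e0 H]]]; exists k => q.
have [|lam lam0 BL] := Bb [set x | nrm q x < 1].
  exact: (continuous_seminorm_ball (grading_continuous q) ltr01).
have cN (c : R) (z : X) j : 0 < c -> nrm j (of_real c *: z) = c * nrm j z.
  by move=> c0; rewrite (seminormZ (grading_seminorm j)) modulus_of_real gtr0_norm.
exists (lam * (2 / e)); first by rewrite !mulr_gt0 ?invr_gt0.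
move=> n; apply: kolmogorov_diam_scale; rewrite ?divr_gt0//.
  move=> x /BL[u /= u1 <-]; rewrite scalerA -rmorphM mulVf ?gt_eqF// rmorph1 scale1r.
  exact: ltW.
move=> u; rewrite /U/closed_unit_ball/= => u1; apply: H; rewrite subr0 cN ?invr_gt0 ?divr_gt0//.
rewrite invf_div (@le_lt_trans _ _ (e / 2))//; last by lra.
by rewrite ler_piMr// divr_ge0// ltW.
Qed.

End Grading.

(** * The associated exponent sequence and the effect of DN *)

Section AssociatedExponent.
Context {R : realType} {s : scalars}.
Local Notation K := (scalar_field R s).
Context {X : tvsType K} {nrm : nat -> X -> R} {E : nat -> R}.
Hypotheses (nrm_grading : hilbertian_grading nrm)
  (nrm_E : forall n, diam_exponent nrm 0 1 n = (E n)%:E).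
Let U k := closed_unit_ball (nrm k).

Lemma kolmogorov_diam_exponent n : kolmogorov_diam n (U 1) (U 0) = (expR (- E n))%:E.
Proof.
have := nrm_E n; rewrite /diam_exponent -/(U 0) -/(U 1).
(* The finite value [E n] excludes a vanishing or infinite diameter. *)
case: (kolmogorov_diam n (U 1) (U 0)) => [r| |]//=; case: ifPn => //; rewrite -ltNge.
by move=> r0 [<-]; rewrite opprK lnK.
Qed.

Lemma associated_exponent_ge0 n : 0 <= E n.
Proof.
have := kolmogorov_diam_le1 n (fun x => grading_mono nrm_grading x (leq0n 1)).
by rewrite -/(U 0) -/(U 1) kolmogorov_diam_exponent lee_fin -expR0 ler_expR oppr_le0.
Qed.

Lemma associated_exponent_mono : {homo E : m n / (m <= n)%N >-> m <= n}.
Proof.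
move=> m n mn; have := kolmogorov_diam_nonincreasing (U 1) (U 0) mn.
by rewrite !kolmogorov_diam_exponent lee_fin ler_expR lerN2.
Qed.

Hypotheses (nrm_DN : underlined_DN nrm)
  (E_summable : forall d, 0 < d ->
    exists C : R, forall M, \sum_(0 <= k < M) expR (- (d * E k)) <= C).

(** Induction on [k]. A large diameter of [U k.+2] in [U k.+1] yields an [n.+1]-dimensional span on
    which [nrm k.+2] is controlled by [nrm k.+1], hence, by DN, by [nrm k]. This bounds the diameter
    of [U k.+2] in [U k] from below, contradicting the induction hypothesis, as [U k.+2] lies in
    [U k.+1]. *)
Lemma kolmogorov_diam_DN k : exists C d, [/\ 0 < C, 0 < d &
  forall n, (kolmogorov_diam n (U k.+1) (U k) <= (C * expR (- (d * E n)))%:E)%E].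
Proof.
elim: k => [|k [C [d [C0 d0 IH]]]].
  by exists 1, 1; split => // n; rewrite kolmogorov_diam_exponent !mul1r.
have [lam [D [/andP[lam0 lam1] D0 DN]]] := nrm_DN k.
(* With this rate the factor [n.+1%:R ^+ 2] costs [lam * d / 2], half of the rate [lam * d] that DN
   provides. *)
have ld0 : 0 < lam * d / 4 by rewrite !mulr_gt0.
have [A A0 HA] := index_le_exp associated_exponent_mono E_summable ld0.
(* One factor 2 comes from [kolmogorov_diam_span], the other makes the final contradiction
   strict. *)
exists (4 * D * C `^ lam * A ^+ 2), (lam * d / 2); split.
- by rewrite !mulr_gt0 ?powR_gt0 ?exprn_gt0.
- by rewrite !mulr_gt0.
move=> n; set b := (_ * expR _)%R; rewrite leNgt; apply/negP => bK.
have b0 : 0 < b by rewrite !mulr_gt0 ?powR_gt0 ?exprn_gt0 ?expR_gt0.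
have [|||x [xfree xG]] := kolmogorov_diam_span _ _ _ b0 bK.
- exact: grading_hilbertian.
- exact: grading_seminorm.
- by move=> x; exact: grading_mono.
set G := (_ / b) in xG.
have G0 : 0 < G by rewrite !mulr_gt0 ?invr_gt0 ?exprn_gt0.
have GE : G * b = 2 * n.+1%:R ^+ 2 by rewrite divfK ?gt_eqF.
clearbody G.
pose c := ((G * D) `^ lam^-1)^-1.
have c0 : 0 < c by rewrite invr_gt0 powR_gt0// mulr_gt0.
have PQ a : c * nrm k.+2 (\sum_i a i *: x i) <= nrm k (\sum_i a i *: x i).
  set y := \sum_i _; have := xG a; rewrite -/y.
  set P := nrm k y; set Q := nrm k.+2 y => QG.
  have P0 : 0 <= P by apply: (seminorm_ge0 (grading_seminorm nrm_grading _)).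
  have : 0 <= Q by apply: (seminorm_ge0 (grading_seminorm nrm_grading _)).
  rewrite le_eqVlt => /predU1P[<-|Q0]; first by rewrite mulr0.
  (* The span estimate followed by DN; cancelling the power [1 - lam] of [Q] and taking the root of
     order [lam] yields the factor [c]. *)
  have : Q `^ lam * Q `^ (1 - lam) <= G * D * P `^ lam * Q `^ (1 - lam).
    rewrite -powRD ?(gt_eqF Q0) ?implybT// addrC subrK powRr1 ?(ltW Q0)//.
    by apply: (le_trans QG); rewrite -!mulrA ler_pM2l// mulrA DN.
  rewrite ler_pM2r ?powR_gt0// => /(ge0_ler_powR (_ : 0 <= lam^-1)).
  rewrite !nnegrE invr_ge0 (ltW lam0) powR_ge0 !mulr_ge0 ?powR_ge0 ?(ltW G0) ?(ltW D0)//.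
  move=> /(_ isT isT isT).
  rewrite powRM ?powR_ge0 ?mulr_ge0 ?(ltW G0) ?(ltW D0)// -!powRrM divff ?gt_eqF//.
  by rewrite !powRr1 ?(ltW Q0)// /c ler_pdivrMl// powR_gt0// mulr_gt0.
have : (c%:E <= kolmogorov_diam n (U k.+2) (U k))%E.
  have := kolmogorov_diam_ge_span (grading_hilbertian nrm_grading k) c0 xfree.
  apply=> a ac.
  by rewrite /U/closed_unit_ball/= -(ler_pM2l c0) mulr1 (le_trans (PQ a)).
have U12 : (kolmogorov_diam n (U k.+2) (U k) <= kolmogorov_diam n (U k.+1) (U k))%E.
  by apply: kolmogorov_diam_mono => // y; exact/le_trans/(grading_mono nrm_grading).
move=> /le_trans/(_ (le_trans U12 (IH n))); rewrite lee_fin /c.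
rewrite -[leLHS]div1r ler_pdivrMr ?powR_gt0 ?mulr_gt0// => cC.
have : 1 <= (C * expR (- (d * E n))) `^ lam * (G * D).
  have Ce0 : 0 <= C * expR (- (d * E n)) by rewrite mulr_ge0 ?expR_ge0 ?(ltW C0).
  have GD0 : 0 <= G * D by rewrite mulr_ge0 ?(ltW G0) ?(ltW D0).
  have -> : (C * expR (- (d * E n))) `^ lam * (G * D) =
      (C * expR (- (d * E n)) * (G * D) `^ lam^-1) `^ lam.
    by rewrite [RHS]powRM ?powR_ge0// -powRrM mulVf ?gt_eqF// powRr1.
  rewrite -[leLHS](f_equal (@^~ lam) (powR1 R)); apply: ge0_ler_powR => //; first exact: ltW.
  - by rewrite nnegrE.
  - by rewrite nnegrE mulr_ge0 ?powR_ge0.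
have -> : (C * expR (- (d * E n))) `^ lam = C `^ lam * expR (- (lam * d * E n)).
  rewrite powRM ?expR_ge0 ?(ltW C0)//; congr (_ * _).
  by rewrite /powR gt_eqF ?expR_gt0// expRK mulrN mulrA.
apply/negP; rewrite -ltNge.
set T := expR _.
rewrite -(ltr_pM2r b0) mul1r.
have -> : C `^ lam * T * (G * D) * b = 2 * D * C `^ lam * T * n.+1%:R ^+ 2.
  by transitivity (C `^ lam * T * D * (G * b)); [ring|rewrite GE; ring].
have nA : n.+1%:R ^+ 2 <= A ^+ 2 * expR (lam * d / 2 * E n).
  have -> : expR (lam * d / 2 * E n) = expR (lam * d / 4 * E n) ^+ 2.
    by rewrite -expRM_natl; congr expR; field.
  by rewrite -exprMn ler_pXn2r ?nnegrE ?ler0n// mulr_ge0 ?expR_ge0 ?(ltW A0).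
have bE : b = 2 * (2 * D * C `^ lam * T * (A ^+ 2 * expR (lam * d / 2 * E n))).
  have -> : 2 * (2 * D * C `^ lam * T * (A ^+ 2 * expR (lam * d / 2 * E n))) =
     4 * D * C `^ lam * A ^+ 2 * (T * expR (lam * d / 2 * E n)) by ring.
  by rewrite /b /T -expRD; congr (_ * expR _); field.
set Z := 2 * D * C `^ lam * T in bE *.
have Z0 : 0 < Z by rewrite !mulr_gt0 ?powR_gt0 ?expR_gt0.
apply: (@le_lt_trans _ _ (Z * (A ^+ 2 * expR (lam * d / 2 * E n)))).
  by rewrite ler_pM2l.
by rewrite {}bE ltr_pMl ?ltr1n// mulr_gt0// mulr_gt0 ?exprn_gt0 ?expR_gt0.
Qed.

End AssociatedExponent.

(** * Local imbeddings *)

Section OrthonormalSequence.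
Context {R : realType} {s : scalars}.
Local Notation K := (scalar_field R s).
Context {X : tvsType K} {nrm : nat -> X -> R} {E : nat -> R}.
Hypotheses (nrm_grading : hilbertian_grading nrm)
  (E_ge0 : forall n, 0 <= E n) (E_mono : {homo E : m n / (m <= n)%N >-> m <= n})
  (E_summable : forall d, 0 < d ->
    exists C : R, forall M, \sum_(0 <= k < M) expR (- (d * E k)) <= C).
Let U k := closed_unit_ball (nrm k).
Context (p : nat) (eps : R).
Hypotheses (eps_gt0 : 0 < eps) (diam_lb : forall q, (p < q)%N -> exists2 c, 0 < c &
  forall n, ((c * expR (- (eps * E n)))%:E <= kolmogorov_diam n (U q) (U p))%E).

(** In the exponent [2 * eps], one [eps] comes from the lower bound on the diameter and the other
    absorbs [n.+1%:R ^+ 2]. *)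
Let good_span : exists C : nat -> R, (forall q, 0 < C q) /\ forall q n, (p < q)%N ->
  exists x : 'I_n.+1 -> X, (forall a, \sum_i a i *: x i = 0 -> forall i, a i = 0) /\
    forall a, nrm q (\sum_i a i *: x i) <=
      C q * expR (2 * eps * E n) * nrm p (\sum_i a i *: x i).
Proof.
have eps2 : 0 < eps / 2 by rewrite divr_gt0.
have [A A0 HA] := index_le_exp E_mono E_summable eps2.
suff /choice[C HC] : forall q, exists C : R, 0 < C /\ forall n, (p < q)%N ->
    exists x : 'I_n.+1 -> X, (forall a, \sum_i a i *: x i = 0 -> forall i, a i = 0) /\
    forall a, nrm q (\sum_i a i *: x i) <=
      C * expR (2 * eps * E n) * nrm p (\sum_i a i *: x i).
  by exists C; split=> [q|q n pq]; have [C0] := HC q => //; apply.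
move=> q; have [qp|pq] := leqP q p; first by exists 1.
have [c c0 Hc] := diam_lb pq.
exists (4 * A ^+ 2 / c); split; first by rewrite !mulr_gt0 ?exprn_gt0 ?invr_gt0.
(* Half of the constant [c] turns the lower bound into the strict one that [kolmogorov_diam_span]
   asks for. *)
move=> n _; pose d := c / 2 * expR (- (eps * E n)).
have d0 : 0 < d by rewrite !mulr_gt0 ?expR_gt0.
have [|||||x [xfree xG]] := @kolmogorov_diam_span _ _ _ n (nrm p) (nrm q) d.
- exact: grading_hilbertian.
- exact: grading_seminorm.
- by move=> x; apply: grading_mono => //; exact: ltnW.
- by [].
- apply: lt_le_trans (Hc n); rewrite lte_fin ltr_pM2r ?expR_gt0//.
  by rewrite ltr_pdivrMr// ltr_pMr// ltr1n.
exists x; split=> // a; apply: (le_trans (xG a)); apply: ler_wpM2r.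
  exact: seminorm_ge0 (grading_seminorm nrm_grading _) _.
have nA : n.+1%:R ^+ 2 <= A ^+ 2 * expR (eps * E n).
  have -> : expR (eps * E n) = expR (eps / 2 * E n) ^+ 2.
    by rewrite -expRM_natl; congr expR; field.
  by rewrite -exprMn ler_pXn2r ?nnegrE ?ler0n// mulr_ge0 ?expR_ge0 ?(ltW A0).
apply: (@le_trans _ _ (2 * (A ^+ 2 * expR (eps * E n)) / d)).
  by rewrite ler_pM2r ?invr_gt0// ler_pM2l.
have -> : 2 * eps * E n = eps * E n + eps * E n by ring.
rewrite /d expRD expRN le_eqVlt; apply/orP; left; apply/eqP; field.
by rewrite !gt_eqF ?expR_gt0.
Qed.

(* The index q n grows to infinity, but so slowly that C (q n) stays dominated by
   e^{eps E_n}: a single sequence is then good for all the norms at once. *)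
Let slow_index (C : nat -> R) : (forall q, 0 < C q) -> exists q : nat -> nat, forall n,
  [/\ (p < q n)%N, C (q n) <= C p.+1 + expR (eps * E n) &
    forall j, (p < j <= p.+1 + n)%N -> C j <= expR (eps * E n) -> (j <= q n)%N].
Proof.
move=> C0; suff /choice[q Hq] : forall n, exists q, [/\ (p < q)%N,
    C q <= C p.+1 + expR (eps * E n) &
    forall j, (p < j <= p.+1 + n)%N -> C j <= expR (eps * E n) -> (j <= q)%N] by exists q.
move=> n; pose P q := (p < q <= p.+1 + n)%N && (C q <= C p.+1 + expR (eps * E n)).
(* The summand [C p.+1] makes [p.+1] admissible for every [n], and the bound [p.+1 + n] guarantees a
   largest admissible index. *)
have exP : exists q, P q by exists p.+1; rewrite /P ltnSn leq_addr/= lerDl expR_ge0.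
have ubP q : P q -> (q <= p.+1 + n)%N by move=> /andP[/andP[]].
case: (ex_maxnP exP ubP) => q /andP[/andP[pq _] Cq] qmax; exists q; split => // j pj Cj.
by apply: qmax; rewrite /P pj (le_trans Cj)// lerDr ltW.
Qed.

(** Given [n] predecessors, the [n.+1]-dimensional span chosen for the index [Q n] contains a
    nonzero vector orthogonal to all of them, which is then normalized for [nrm p]. *)
Lemma orthonormal_sequence (h : X -> X -> K) : semi_inner h (fun x => nrm p x ^+ 2) ->
  exists g : nat -> X, [/\ forall n, nrm p (g n) = 1,
    forall m n, (m < n)%N -> h (g n) (g m) = 0 &
    forall q, exists2 D, 0 < D & forall n, nrm q (g n) <= D * expR (3 * eps * E n)].
Proof.
move=> hN; have [C [C0 HC]] := good_span; have [Q HQ] := slow_index C0.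
have [ps p0 _] := grading_hilbertian nrm_grading p.
have /choice[nxt Hnxt] : forall l : seq X, exists y, [/\ nrm p y = 1,
    forall z, z \in l -> h y z = 0 &
    nrm (Q (size l)) y <= C (Q (size l)) * expR (2 * eps * E (size l))].
  move=> l; have [pQ _ _] := HQ (size l).
  have [x [xfree xC]] := HC _ (size l) pQ.
  have [a [[i ai] ae]] := span_orthogonal x (fun j : 'I_(size l) => l`_j) hN.
  have [y0] : exists y0, y0 = \sum_i a i *: x i by eexists.
  move=> y0E; have := xC a; rewrite -y0E in ae *; move=> y0C.
  have y0N : 0 < nrm p y0.
    rewrite lt_def (seminorm_ge0 ps) andbT; apply: contra_neq ai => /p0.
    by rewrite y0E => /xfree.
  have cN q : nrm q (of_real (nrm p y0)^-1 *: y0) = (nrm p y0)^-1 * nrm q y0.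
    rewrite (seminormZ (grading_seminorm nrm_grading q)) modulus_of_real.
    by rewrite gtr0_norm ?invr_gt0.
  exists (of_real (nrm p y0)^-1 *: y0); split.
  - by rewrite cN mulVf ?gt_eqF.
  - move=> z zl; rewrite (semi_innerZl hN).
    have il : (index z l < size l)%N by rewrite index_mem.
    by have := ae (Ordinal il); rewrite /= nth_index// => ->; rewrite mulr0.
  - by rewrite cN ler_pdivrMl// mulrC.
(* Each choice depends on all earlier ones, so the recursion runs on the list of the vectors chosen
   so far. *)
pose pre n := iter n (fun l => rcons l (nxt l)) [::].
have size_pre n : size (pre n) = n by elim: n => //= n IH; rewrite size_rcons IH.
pose g n := nxt (pre n).
have g_pre m n : (m < n)%N -> g m \in pre n.
  elim: n => // n IH; rewrite ltnS leq_eqVlt /= mem_rcons inE.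
  by move=> /predU1P[->|/IH ->]; rewrite ?eqxx ?orbT.
exists g; split=> [n|m n mn|q].
- by have [] := Hnxt (pre n).
- by have [_ + _] := Hnxt (pre n); apply; exact: g_pre.
pose q' := maxn q p.+1.
have pq' : (p < q')%N by rewrite leq_max ltnSn orbT.
have [N _ HN] : \forall n \near \oo, C q' <= expR (eps * E n) by exact: exponent_exp_dvg.
(* From [M] on, [q'] satisfies both conditions that force [q' <= Q n]; the finitely many earlier
   vectors are covered by their sum in the constant. *)
pose M := maxn N q'.
have g0 n : 0 <= nrm q' (g n) by exact: seminorm_ge0 (grading_seminorm nrm_grading _) _.
exists (C p.+1 + 1 + \sum_(n < M) nrm q' (g n)).
  by rewrite ltr_pwDl ?sumr_ge0// addr_gt0.
move=> n; apply: (le_trans (grading_mono nrm_grading (g n) (leq_maxl q p.+1))).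
rewrite -/q' mulrDl; have [Mn|nM] := leqP M n.
  rewrite -[leLHS]addr0; apply: lerD; last by rewrite mulr_ge0 ?sumr_ge0 ?expR_ge0.
  have [pQ CQ Qmax] := HQ n.
  have q'Q : (q' <= Q n)%N.
    apply: Qmax; last by apply: HN; rewrite /= (leq_trans _ Mn)// leq_maxl.
    by rewrite pq' (leq_trans _ (leq_addl _ _))// (leq_trans _ Mn)// leq_maxr.
  apply: (le_trans (grading_mono nrm_grading _ q'Q)).
  have [_ _] := Hnxt (pre n); rewrite size_pre => /le_trans; apply.
  have -> : 3 * eps * E n = eps * E n + 2 * eps * E n by ring.
  rewrite expRD mulrA ler_wpM2r ?expR_ge0// (le_trans CQ)// mulrDl mul1r lerD2r.
  by rewrite ler_peMr ?(ltW (C0 _))// -expR0 ler_expR mulr_ge0 ?(ltW eps_gt0).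
rewrite -[leLHS]add0r; apply: lerD.
  by rewrite mulr_ge0 ?expR_ge0// addr_ge0 ?(ltW (C0 _)).
apply: (@le_trans _ _ (\sum_(n < M) nrm q' (g n))).
  by rewrite (bigD1 (Ordinal nM))//= lerDl sumr_ge0.
rewrite ler_peMr ?sumr_ge0// -expR0 ler_expR !mulr_ge0 ?(ltW eps_gt0)//.
Qed.

End OrthonormalSequence.

(** * The operator attached to an orthonormal sequence *)

Section Imbedding.
Context {R : realType} {s : scalars}.
Local Notation K := (scalar_field R s).
Context {X : tvsType K} {nrm : nat -> X -> R} {E : nat -> R}.
Hypotheses (X_frechet : frechet X) (nrm_grading : hilbertian_grading nrm)
  (E_summable : forall d, 0 < d ->
    exists C : R, forall M, \sum_(0 <= k < M) expR (- (d * E k)) <= C).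
Local Notation PS := (power_series (s := s) E).

Let nrm_ge0 k x : 0 <= nrm k x.
Proof. exact: seminorm_ge0 (grading_seminorm nrm_grading k) x. Qed.

(** Completeness is stated for filters; it is applied to the image of [\oo] under [S], with images
    of tails as the small sets. *)
Lemma frechet_series_cvg (S : nat -> X) :
    (forall k e, 0 < e -> exists M, forall m n, (M <= m)%N -> (M <= n)%N ->
      nrm k (S m - S n) < e) ->
  exists x, forall k e, 0 < e -> \forall n \near \oo, nrm k (S n - x) < e.
Proof.
move=> cS; have [_ _ complete] := X_frechet.
have [|x Sx] := complete (S @ \oo) _.
  move=> A /(grading_nbhs nrm_grading)[k [e [e0 HA]]].
  have [M HM] := cS k e e0.
  exists [set S n | n in [set n | (M <= n)%N]]; first by exists M => // n Mn; exists n.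
  by move=> _ _ [m Mm <-] [n Mn <-]; apply: HA; rewrite subr0; exact: HM.
exists x => k e e0; apply: (Sx [set y | nrm k (y - x) < e]).
by apply/(grading_nbhs nrm_grading); exists k, e.
Qed.

Lemma frechet_limit_unique (S : nat -> X) x y :
    (forall e, 0 < e -> \forall n \near \oo, nrm 0 (S n - x) < e) ->
    (forall e, 0 < e -> \forall n \near \oo, nrm 0 (S n - y) < e) -> x = y.
Proof.
move=> Sx Sy; apply/eqP; rewrite -subr_eq0; apply/eqP.
have [n0 nd _] := grading_hilbertian nrm_grading 0; apply: nd.
apply/eqP; rewrite eq_le nrm_ge0 andbT; apply/ler_addgt0Pr => e e0; rewrite add0r.
have e2 : 0 < e / 2 by rewrite divr_gt0.
near \oo => n.
have -> : x - y = (S n - y) - (S n - x) by rewrite opprB [RHS]addrC addrA subrK.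
apply: (le_trans (seminormB _ _ n0)); rewrite [leRHS]splitr.
by apply/ltW/ltrD; near: n; [exact: Sy|exact: Sx].
Unshelve. all: by end_near. Qed.

Context (g : nat -> X) (p : nat) (h : X -> X -> K) (r rho : R).
Hypotheses (hN : semi_inner h (fun x => nrm p x ^+ 2))
  (g_norm : forall n, nrm p (g n) = 1)
  (g_orth : forall m n, (m < n)%N -> h (g n) (g m) = 0)
  (g_le : forall q, exists2 D, 0 < D & forall n, nrm q (g n) <= D * expR (rho * E n))
  (r_rho : r + rho < 1) (r_lt1 : r < 1) (E_ge0 : forall n, 0 <= E n).

Let S (xi : PS) N : X := \sum_(0 <= k < N) ((xi k : K) * of_real (expR (r * E k))) *: g k.

(** [r2] is midway between [r + rho] and 1, and [d] is the gap: [r2 = r + rho + d]. *)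
Let r2 := (1 + (r + rho)) / 2.
Let d := (1 - (r + rho)) / 2.

(** Bounding coefficients by the norm of index [r2] pays for the growth [r] of the weights and [rho]
    of the [g k], and still leaves the summable factor [expR (- (d * E k))]. *)
Let S_norm q : exists2 D, 0 < D & forall xi M N, (M <= N)%N ->
  nrm q (S xi N - S xi M) <= D * ps_norm r2 xi * \sum_(M <= k < N) expR (- (d * E k)).
Proof.
have [D D0 HD] := g_le q; exists D => // xi M N MN.
have nq := grading_seminorm nrm_grading q.
have -> : S xi N - S xi M =
    \sum_(M <= k < N) ((xi k : K) * of_real (expR (r * E k))) *: g k.
  by rewrite /S (big_cat_nat (n := M) (m := 0%N) (p := N))//= addrAC subrr add0r.
have nsum (l : seq nat) (F : nat -> X) : nrm q (\sum_(i <- l) F i) <= \sum_(i <- l) nrm q (F i).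
  elim/big_rec2: _ => [|i u v _ uv]; first by rewrite (seminorm0 nq).
  by rewrite (le_trans (seminormD nq _ _))// lerD2l.
apply: (le_trans (nsum _ _)); rewrite mulr_sumr; apply: ler_sum => k _.
rewrite (seminormZ nq) modulusM modulus_of_real ger0_norm ?expR_ge0//.
have r21 : r2 < 1 by rewrite /r2; move: r_rho; lra.
apply: (@le_trans _ _ (modulus (xi k) * expR (r * E k) * (D * expR (rho * E k)))).
  by rewrite ler_wpM2l// mulr_ge0 ?modulus_ge0 ?expR_ge0.
have -> : modulus (xi k) * expR (r * E k) * (D * expR (rho * E k)) =
    D * (modulus (xi k) * expR (r2 * E k)) * expR (- (d * E k)).
  have -> : r2 * E k = r * E k + rho * E k + d * E k by rewrite /r2 /d; field.
  rewrite !expRD expRN; field; by rewrite gt_eqF ?expR_gt0.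
by rewrite ler_wpM2r ?expR_ge0// ler_wpM2l ?(ltW D0)// ps_norm_coef.
Qed.

Let S_cauchy xi k e : 0 < e -> exists M, forall m n, (M <= m)%N -> (M <= n)%N ->
  nrm k (S xi m - S xi n) < e.
Proof.
move=> e0; have [D D0 HD] := S_norm k.
have d0 : 0 < d by rewrite /d; move: r_rho; lra.
have [C HC] := E_summable d0.
pose w N := \sum_(0 <= k < N) expR (- (d * E k)).
have w_mono : nondecreasing_seq w.
  by apply/nondecreasing_seqP => n; rewrite /w big_nat_recr//= lerDl expR_ge0.
have w_cvg : cvgn w.
  by apply: nondecreasing_is_cvgn => //; exists C => _ [n _ <-]; exact: HC.
pose c := D * ps_norm r2 xi + 1.
have c0 : 0 < c by rewrite ltr_wpDl// mulr_ge0 ?ps_norm_ge0// ltW.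
have ec : 0 < e / c by rewrite divr_gt0.
have [M _ HM] : \forall n \near \oo, `|limn w - w n| < e / c.
  exact: (cvgrPdist_lt _ _).1 w_cvg _ ec.
have main m n : (M <= m)%N -> (m <= n)%N -> nrm k (S xi n - S xi m) < e.
  move=> Mm mn; apply: (le_lt_trans (HD xi m n mn)).
  have wmn : \sum_(m <= k < n) expR (- (d * E k)) = w n - w m.
    by rewrite /w (big_cat_nat (n := m) (m := 0%N) (p := n))//= addrAC subrr add0r.
  have wlim : w n <= limn w by exact: nondecreasing_cvgn_le.
  have := HM m Mm; rewrite /= ltr_norml => /andP[_ wm].
  apply: (@le_lt_trans _ _ (c * (w n - w m))).
    by rewrite wmn ler_wpM2r ?subr_ge0 ?w_mono// lerDl.
  by rewrite -ltr_pdivlMl// mulrC; move: wlim wm; lra.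
exists M => m n Mm Mn; have [mn|/ltnW nm] := leqP m n; last exact: main.
by rewrite -opprB (seminormN _ (grading_seminorm nrm_grading k)); exact: main.
Qed.

Let S_linear a xi eta N : S (a *: xi + eta) N = a *: S xi N + S eta N.
Proof.
rewrite /S scaler_sumr -big_split; apply: eq_bigr => k _.
rewrite (_ : (a *: xi + eta) k = a * xi k + eta k)//=.
by rewrite mulrDl scalerDl scalerA mulrA.
Qed.

(** Pythagoras along the orthonormal [g k]: for [nrm p] the partial sums of the operator reproduce
    exactly those of the norm of index [r]. *)
Let S_orth xi N : nrm p (S xi N) ^+ 2 =
  \sum_(0 <= k < N) modulus (xi k) ^+ 2 * expR (2 * r * E k).
Proof.
elim: N => [|N IH].
  by rewrite /S !big_geq// (seminorm0 (grading_seminorm nrm_grading p)) expr0n.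
have SN : h (S xi N) (((xi N : K) * of_real (expR (r * E N))) *: g N) = 0.
  rewrite (semi_innerZr hN) (semi_inner_suml hN) big_nat_cond big1 ?mulr0// => k.
  rewrite andbT => /andP[_ kN].
  by rewrite (semi_innerC hN (g N)) g_orth// conjugate0 mulr0.
rewrite big_nat_recr//= -IH {1}/S big_nat_recr//= -/(S xi N).
rewrite (semi_inner_pythagoras hN SN); congr (_ + _).
rewrite (semi_inner_normZ hN) g_norm expr1n mulr1 modulusM modulus_of_real.
by rewrite ger0_norm ?expR_ge0// exprMn -expRM_natl mulrA.
Qed.

(** [T] is the pointwise limit of the partial sums [S]. Continuity passes to the limit from
    [S_norm], the lower estimate from [S_orth]. *)
Lemma local_imbedding_of_orthonormal : exists T : {linear PS -> X}, local_imbedding r T.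
Proof.
have /choice[T HT] : forall xi, exists x, forall k e, 0 < e ->
    \forall n \near \oo, nrm k (S xi n - x) < e.
  by move=> xi; apply: frechet_series_cvg => k e; exact: S_cauchy.
have Tlin : linear T.
  move=> a xi eta; apply: (@frechet_limit_unique (S (a *: xi + eta))); first exact: HT.
  move=> e e0; have n0 := grading_seminorm nrm_grading 0.
  (* Adding 1 keeps the divisor positive when [a = 0]. *)
  pose c := modulus a + 1; have c0 : 0 < c by rewrite ltr_wpDl// modulus_ge0.
  have e1 : 0 < e / 2 / c by rewrite !divr_gt0.
  have e2 : 0 < e / 2 by rewrite divr_gt0.
  near=> n.
  have -> : S (a *: xi + eta) n - (a *: T xi + T eta) =
      a *: (S xi n - T xi) + (S eta n - T eta).
    by rewrite S_linear scalerBr opprD addrACA.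
  apply: (le_lt_trans (seminormD n0 _ _)); rewrite (seminormZ n0) [ltRHS]splitr.
  apply: ltrD; last by near: n; exact: HT.
  apply: (@le_lt_trans _ _ (modulus a * (e / 2 / c))).
    by rewrite ler_wpM2l ?modulus_ge0// ltW//; near: n; exact: HT.
  by rewrite mulrA ltr_pdivrMr// mulrC ltr_pM2l// ltrDl.
pose T' : {linear PS -> X} := HB.pack T (GRing.isLinear.Build _ _ _ _ T Tlin).
exists T'; have d0 : 0 < d by rewrite /d; move: r_rho; lra.
have r21 : r2 < 1 by rewrite /r2; move: r_rho; lra.
have T_le k : exists2 D, 0 < D & forall xi, nrm k (T xi) <= D * ps_norm r2 xi.
  have [D D0 HD] := S_norm k; have [C HC] := E_summable d0.
  have C0 : 0 < C by apply: lt_le_trans (HC 1); rewrite big_nat1 expR_gt0.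
  exists (D * C) => [|xi]; first by rewrite mulr_gt0.
  apply/ler_addgt0Pr => e e0; near \oo => n.
  have nk := grading_seminorm nrm_grading k.
  have -> : T xi = S xi n - (S xi n - T xi) by rewrite opprB addrC subrK.
  apply: (le_trans (seminormB _ _ nk)); apply: lerD; last first.
    by apply/ltW; near: n; exact: HT.
  have := HD xi 0 n (leq0n n); rewrite {2}/S big_geq// subr0 => /le_trans; apply.
  by rewrite [leRHS]mulrAC ler_wpM2l// mulr_ge0 ?ps_norm_ge0// ltW.
split.
  move=> xi A /(grading_nbhs nrm_grading)[k [e [e0 HA]]].
  have [D D0 HD] := T_le k.
  apply/(nbhs_psP E_ge0); exists r2, (e / D); split; rewrite ?divr_gt0// => eta etae.
  apply: HA; rewrite -raddfB/=; apply: (le_lt_trans (HD _)).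
  by rewrite mulrC -ltr_pdivlMr.
exists (nrm p); first exact: grading_continuous.
(* By [S_orth] the values [nrm p (S xi n)] increase with [n] and approach [nrm p (T xi)], so each of
   them is at most that limit. *)
exists 1 => // xi; rewrite mul1r; apply: ps_norm_le => // N.
rewrite -S_orth ler_pXn2r ?nnegrE ?nrm_ge0//.
apply/ler_addgt0Pr => e e0; near \oo => n.
have np := grading_seminorm nrm_grading p.
apply: (@le_trans _ _ (nrm p (S xi n))).
  rewrite -(@ler_pXn2r _ 2) ?nnegrE ?nrm_ge0// !S_orth.
  rewrite [leRHS](big_cat_nat (n := N))//=; last by near: n; exact: nbhs_infty_ge.
  by rewrite lerDl sumr_ge0// => k _; rewrite mulr_ge0 ?sqr_ge0 ?expR_ge0.
rewrite -[S xi n](subrK (T xi)) addrC; apply: (le_trans (seminormD np _ _)).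
by rewrite lerD2l ltW//; near: n; exact: HT.
Unshelve. all: by end_near. Qed.

End Imbedding.

(** * The three assertions *)

Section Equivalences.
Context {R : realType} {s : scalars}.
Local Notation K := (scalar_field R s).
Context {X : tvsType K} {nrm : nat -> X -> R} {E : nat -> R}.
Hypotheses (nrm_grading : hilbertian_grading nrm)
  (E_ge0 : forall n, 0 <= E n) (E_mono : {homo E : m n / (m <= n)%N >-> m <= n})
  (E_summable : forall d, 0 < d ->
    exists C : R, forall M, \sum_(0 <= k < M) expR (- (d * E k)) <= C).
Local Notation PS := (power_series (s := s) E).
Let U k := closed_unit_ball (nrm k).

(** Assertion (2) without limits and quotients: up to an additive constant depending on [q], the
    exponents for [p] and [q] are at most [eps * E n]. *)
Definition subexponential_diam := forall eps : R, 0 < eps -> exists2 p, (1 <= p)%N &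
  forall q, (p < q)%N -> exists2 c : R, 0 < c & forall n,
    ((c * expR (- (eps * E n)))%:E <= kolmogorov_diam n (U q) (U p))%E.

Let nrm_ge0 k x : 0 <= nrm k x.
Proof. exact: seminorm_ge0 (grading_seminorm nrm_grading k) x. Qed.

Let diam_le1 p q n : (p < q)%N -> (kolmogorov_diam n (U q) (U p) <= 1)%E.
Proof.
by move=> pq; apply: kolmogorov_diam_le1 => x; apply: grading_mono => //; exact: ltnW.
Qed.

(** Diameters decrease in [n], so the bound at the threshold [N] serves all smaller [n] once [c] is
    replaced by [c * expR (- (eps * E N))]. *)
Lemma subexponential_diam_of_near :
    (forall eps : R, 0 < eps -> exists2 p, (1 <= p)%N &
      forall q, (p < q)%N -> exists2 c : R, 0 < c & \forall n \near \oo,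
        ((c * expR (- (eps * E n)))%:E <= kolmogorov_diam n (U q) (U p))%E) ->
  subexponential_diam.
Proof.
move=> H eps eps0; have [p p1 Hp] := H eps eps0; exists p => // q pq.
have [c c0 [N _ HN]] := Hp q pq.
exists (c * expR (- (eps * E N))) => [|n]; first by rewrite mulr_gt0 ?expR_gt0.
have [Nn|/ltnW nN] := leqP N n.
  apply: le_trans (HN n Nn); rewrite lee_fin ler_pM2r ?expR_gt0//.
  by rewrite ler_piMr ?(ltW c0)// -expR0 ler_expR oppr_le0 mulr_ge0// ltW.
apply: le_trans (kolmogorov_diam_nonincreasing _ _ nN).
apply: le_trans (HN N (leqnn N)); rewrite lee_fin ler_piMr//.
  by rewrite mulr_ge0 ?expR_ge0// ltW.
by rewrite -expR0 ler_expR oppr_le0 mulr_ge0// ltW.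
Qed.

(** A limsup below [eps] gives the diameter bound eventually, with [c = 1]. Conversely [c] is
    absorbed by using the rate [eps / 2], as [E] tends to infinity. The infimum is never negative,
    because the diameters are at most 1. *)
Lemma diam_exponent_inf_eq0 :
  ereal_inf [set ereal_sup
      [set limn_esup (fun n => diam_exponent nrm p q n * ((E n)^-1)%:E)%E
      | q in [set q : nat | (p < q)%N]]
    | p in [set p : nat | (1 <= p)%N]] = 0%E <-> subexponential_diam.
Proof.
have E_gt0 : \forall n \near \oo, 0 < E n.
  near=> n; apply: (@lt_le_trans _ _ 1) => //.
  by near: n; exact: (exponent_dvg E_mono E_summable).
split=> [inf0|sub].
  apply: subexponential_diam_of_near => eps eps0.
  have : (ereal_inf [set ereal_sup
      [set limn_esup (fun n => diam_exponent nrm p q n * ((E n)^-1)%:E)%E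
      | q in [set q : nat | (p < q)%N]]
    | p in [set p : nat | (1 <= p)%N]] < eps%:E)%E by rewrite inf0 lte_fin.
  move=> /ereal_inf_lt[_ [p p1 <-] supeps]; exists p => // q pq; exists 1 => //.
  have /ereal_inf_lt[_ [V Voo <-] Veps] : (limn_esup (fun n =>
      diam_exponent nrm p q n * ((E n)^-1)%:E) < eps%:E)%E.
    by apply: le_lt_trans supeps; apply: ereal_sup_ubound; exists q.
  near=> n; have En : 0 < E n by near: n.
  have : (diam_exponent nrm p q n * ((E n)^-1)%:E < eps%:E)%E.
    apply: le_lt_trans Veps; apply: ereal_sup_ubound; exists n => //.
    by near: n; exact: Voo.
  rewrite /diam_exponent mul1r -/(U p) -/(U q).
  have := kolmogorov_diam_ge0 n (U q) (U p).
  case: (kolmogorov_diam n (U q) (U p)) => [k| |]//=; last by move=> _ _; rewrite leey.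
  (* A vanishing diameter would give the quotient [+oo], against the strict bound. *)
  move=> _; case: ifPn => [k0|]; first by rewrite gt0_mulye ?lte_fin ?invr_gt0.
  rewrite -ltNge => k0; rewrite -EFinN -EFinM lte_fin ltr_pdivrMr// => /ltW kE.
  by rewrite lee_fin -[leRHS]lnK// ler_expR lerNl.
have lim_ge0 p q : (p < q)%N ->
    (0 <= limn_esup (fun n => diam_exponent nrm p q n * ((E n)^-1)%:E))%E.
  move=> pq; apply: limf_esup_ge0; first by move=> [N _ /(_ N (leqnn N))].
  move=> n; rewrite mule_ge0 ?lee_fin ?invr_ge0// /diam_exponent oppe_ge0 lne_le0.
  exact: diam_le1.
apply/eqP; rewrite eq_le; apply/andP; split; last first.
  apply: le_ereal_inf_tmp => _ [p p1 <-].
  apply: (le_trans (lim_ge0 p p.+1 (ltnSn p))).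
  by apply: ereal_sup_ubound; exists p.+1; rewrite /= ?ltnSn.
apply/lee_addgt0Pr => eps eps0; rewrite add0e.
have eps2 : 0 < eps / 2 by rewrite divr_gt0.
have [p p1 Hp] := sub _ eps2.
apply: ge_ereal_inf; eexists; first by exists p.
apply: ge_ereal_sup => _ [q pq <-]; have [c c0 Hc] := Hp q pq.
have cE : \forall n \near \oo, c^-1 <= expR (eps / 2 * E n).
  exact: (exponent_exp_dvg E_mono E_summable).
pose V := [set n | 0 < E n /\ c^-1 <= expR (eps / 2 * E n)].
apply: ge_ereal_inf; exists (ereal_sup ((fun n => diam_exponent nrm p q n * ((E n)^-1)%:E)%E @` V)).
  by exists V => //; apply: filterI.
apply: ge_ereal_sup => _ [n [En cn] <-].
have := Hc n; have := diam_le1 n pq; rewrite /diam_exponent -/(U p) -/(U q).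
case: (kolmogorov_diam n (U q) (U p)) => [k| |]//= _; rewrite lee_fin => ck.
have ce0 : 0 < c * expR (- (eps / 2 * E n)) by rewrite mulr_gt0 ?expR_gt0.
have k0 := lt_le_trans ce0 ck.
rewrite (lt_geF k0) -EFinN -EFinM lee_fin ler_pdivrMr// lerNl.
rewrite -(ler_expR) lnK//; apply: le_trans ck.
have -> : - (eps * E n) = - (eps / 2 * E n) - (eps / 2 * E n) by field.
rewrite expRD ler_pM2r ?expR_gt0// expRN invf_ple ?posrE ?expR_gt0//.
Unshelve. all: by end_near. Qed.

(** The sequence [expR (- (eps * E n))] is eventually below the diameters of some bounded set, and
    these are at most a multiple of the diameters of any [U q] in one fixed [U k]. *)
Lemma subexponential_diam_of_exp_decay :
  exp_decay E `<=` approx_diametral_dim X -> subexponential_diam.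
Proof.
move=> sub; apply: subexponential_diam_of_near => eps eps0.
have [A [B [A0 Bb kd0 tkd]]] :
    approx_diametral_dim X (fun n => of_real (expR (- (eps * E n))) : K).
  apply: sub; exists eps => //; apply: nearW => n.
  by rewrite modulus_of_real ger0_norm ?expR_ge0.
have [k Hk] := kolmogorov_diam_bounded nrm_grading Bb A0.
(* [k] may be 0 while the index has to be at least 1; passing to the smaller ball [U k.+1] only
   increases the diameters. *)
exists k.+1 => // q kq; have [c c0 Hc] := Hk q.
have /cvgr0Pnorm_lt/(_ 1 ltr01) tk1 := tkd.
exists c^-1; first by rewrite invr_gt0.
near=> n.
have : `|(of_real (expR (- (eps * E n))) : K) /
    of_real (fine (kolmogorov_diam n B A))| < 1 by near: n.
have diam_mono : (kolmogorov_diam n (U q) (U k) <= kolmogorov_diam n (U q) (U k.+1))%E.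
  by apply: kolmogorov_diam_mono => // y; exact/le_trans/(grading_mono nrm_grading).
have := le_trans (Hc n) (lee_wpmul2l (ltW (_ : (0 < c%:E)%E)) diam_mono).
rewrite lte_fin => /(_ c0); have := kd0 n; have := diam_le1 n kq.
have := kolmogorov_diam_ge0 n (U q) (U k.+1).
case: (kolmogorov_diam n (U q) (U k.+1)) => [u| |]//= _ _.
case: (kolmogorov_diam n B A) => [v| |]//=; rewrite -EFinM !lte_fin !lee_fin => v0 vu.
rewrite normr_modulus -(rmorph1 of_real) ltr_of_real modulusM modulusV !modulus_of_real.
rewrite gtr0_norm ?expR_gt0// gtr0_norm// ltr_pdivrMr// mul1r => /ltW ev.
by rewrite ler_pdivrMl// (le_trans ev).
Unshelve. all: by end_near. Qed.

(** The bounded set is the image of [ps_ball]. On the span of the images of the first [n.+1] unit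
    vectors, the lower estimate for [T] and [ps_span_ball] bound its diameter from below at rate
    [1 - r]. *)
Lemma exp_decay_of_local_imbeddings :
    (forall r : R, 0 < r < 1 -> exists T : {linear PS -> X}, local_imbedding r T) ->
  exp_decay E `<=` approx_diametral_dim X.
Proof.
move=> H; apply: (approx_diametral_dim_sup E_mono E_summable) => d d0.
(* The rate [1 - r] has to be at most [d]; the value 1/2 keeps [r] positive for large [d]. *)
pose r := Num.max (1 - d) (1 / 2).
have r01 : 0 < r < 1.
  by rewrite lt_max gt_max; apply/andP; split; [apply/orP; right|apply/andP; split]; lra.
have [/andP[r0 r1] dr] : 0 < r < 1 /\ 1 - r <= d.
  by split => //; rewrite lerBlDr addrC -lerBlDr le_max lexx.
have [T [Tcont [P Pcont [c c0 TP]]]] := H r r01.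
have [k [C [C0 PC]]] := continuous_seminorm_gradingP nrm_grading Pcont.
have Tk x : c / C * ps_norm r x <= nrm k (T x).
  by rewrite mulrAC ler_pdivrMr// [leRHS]mulrC; exact: le_trans (TP x) (PC _).
have cC : 0 < c / C by rewrite divr_gt0.
exists (U k), (T @` ps_ball), (c / C); split => //.
- have := continuous_seminorm_ball (grading_continuous nrm_grading k) ltr01.
  by apply: filterS => x; exact: ltW.
- move=> A A0; have T0A : nbhs (T 0) A by rewrite linear0.
  have : nbhs (0 : PS) (T @^-1` A) by exact: (Tcont 0 A T0A).
  move=> /(ps_ball_bounded E_ge0)[lam lam0 BL]; exists lam => // _ [x /BL[u Au <-] <-].
  by exists (T u) => //; rewrite linearZ.
move=> n.
have spanE (a : 'I_n.+1 -> K) :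
    \sum_i a i *: T (ps_basis i) = T (\sum_i a i *: ps_basis i).
  by rewrite linear_sum; apply: eq_bigr => i _; rewrite linearZ.
apply: (@le_trans _ _ (c / C * expR (- ((1 - r) * E n)))%:E).
  by rewrite lee_fin ler_pM2l// ler_expR lerN2 ler_wpM2r.
apply: (kolmogorov_diam_ge_span (x := fun i : 'I_n.+1 => T (ps_basis i))).
- exact: grading_hilbertian.
- by rewrite mulr_gt0 ?expR_gt0.
- move=> a; rewrite spanE => Ta0 i; apply/eqP; rewrite -modulus_eq0 eq_le modulus_ge0 andbT.
  have := Tk (\sum_i a i *: ps_basis i); rewrite Ta0 (seminorm0 (grading_seminorm nrm_grading k)).
  rewrite pmulr_rle0// => /(le_trans (ps_norm_coef _ i r1)).
  by rewrite ps_span_coef pmulr_lle0 ?expR_gt0.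
move=> a; rewrite spanE => aT; exists (\sum_i a i *: ps_basis i) => //.
apply: (ps_span_ball E_mono (ltW r1)).
apply: (le_trans (ps_norm_sum_le _ _ r1)).
rewrite ler_pXn2r ?nnegrE ?ps_norm_ge0 ?expR_ge0//.
by rewrite -(ler_pM2l cC) (le_trans (Tk _)).
Qed.

Lemma local_imbeddings_of_subexponential_diam : frechet X -> subexponential_diam ->
  forall r : R, 0 < r < 1 -> exists T : {linear PS -> X}, local_imbedding r T.
Proof.
move=> X_frechet sub r /andP[r0 r1].
(* The sequence [g] grows at rate [3 * eps = (1 - r) / 2], so that [r + 3 * eps] stays below 1. *)
pose eps := (1 - r) / 6; have eps0 : 0 < eps by rewrite /eps; lra.
have [p p1 Hp] := sub eps eps0.
have [h hN] := hilbertian_normP (grading_hilbertian nrm_grading p).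
have [g [g1 go gD]] := orthonormal_sequence nrm_grading E_ge0 E_mono E_summable eps0 Hp hN.
apply: (local_imbedding_of_orthonormal X_frechet nrm_grading E_summable hN g1 go gD) => //.
by rewrite /eps; lra.
Qed.

End Equivalences.

Theorem theorem2p9 (R : realType) (s : scalars)
    (X : tvsType (scalar_field R s)) (nrm : nat -> X -> R) (E : nat -> R)
    (X_frechet : frechet X) (X_nuclear : nuclear X)
    (nrm_grading : hilbertian_grading nrm)
    (nrm_DN : underlined_DN nrm) (nrm_Omega : property_Omega nrm)
    (nrm_E : forall n, diam_exponent nrm 0 1 n = (E n)%:E)
    (E_nuclear : nuclear (power_series (s := s) E)) :
  let assertion1 :=
    approx_diametral_dim X = approx_diametral_dim (power_series (s := s) E) in
  let assertion2 :=
    ereal_inf [set ereal_sup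
        [set limn_esup (fun n => diam_exponent nrm p q n * ((E n)^-1)%:E)%E
        | q in [set q : nat | (p < q)%N]]
      | p in [set p : nat | (1 <= p)%N]] = 0%E in
  let assertion3 :=
    forall r : R, 0 < r < 1 ->
      exists T : {linear power_series (s := s) E -> X}, local_imbedding r T in
  (assertion1 <-> assertion2) /\ (assertion2 <-> assertion3).
Proof.
move=> assertion1 assertion2 assertion3.
have E_ge0 := associated_exponent_ge0 nrm_grading nrm_E.
have E_mono := associated_exponent_mono nrm_E.
have E_sum d : 0 < d -> exists C : R, forall M, \sum_(0 <= k < M) expR (- (d * E k)) <= C.
  exact: nuclear_ps_summable E_ge0 d E_nuclear.
have ps_dim : approx_diametral_dim (power_series (s := s) E) = exp_decay E.
  apply/seteqP; split.
    exact/(approx_diametral_dim_sub E_mono E_sum)/ps_kolmogorov_diam_le.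
  exact/(approx_diametral_dim_sup E_mono E_sum)/ps_kolmogorov_diam_ge.
have X_dim : approx_diametral_dim X `<=` exp_decay E.
  apply: (approx_diametral_dim_sub E_mono E_sum) => U B U0 Bb.
  have [k Hk] := kolmogorov_diam_bounded nrm_grading Bb U0.
  (* The free index is taken to be [k.+1], the neighbour for which DN gives exponential decay. *)
  have [c c0 Hc] := Hk k.+1.
  have [C [d [C0 d0 Cd]]] := kolmogorov_diam_DN nrm_grading nrm_E nrm_DN E_sum k.
  exists (c * C), d; split=> // n; apply: (le_trans (Hc n)).
  by rewrite -mulrA EFinM lee_pmul2l ?Cd ?lte_fin.
have H12 : assertion1 -> assertion2.
  move=> dimE; apply/(diam_exponent_inf_eq0 nrm_grading E_ge0 E_mono E_sum).
  apply: (subexponential_diam_of_exp_decay nrm_grading E_ge0).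
  by rewrite -ps_dim -dimE.
have H23 : assertion2 -> assertion3.
  move=> /(diam_exponent_inf_eq0 nrm_grading E_ge0 E_mono E_sum).
  exact: local_imbeddings_of_subexponential_diam.
have H31 : assertion3 -> assertion1.
  move=> imb; rewrite /assertion1 ps_dim; apply/seteqP; split=> //.
  exact: exp_decay_of_local_imbeddings nrm_grading E_ge0 E_mono E_sum imb.
by split; split; auto.
Qed.
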